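(* Let $a_0=\Big(1+\frac12W\big(-\frac{2}{e^2}\big)\Big)^{1/2}=0.892643\ldots$ and let $a\in(a_0,1]$. Then $$R_{\partial\to id_1}(a)=\frac1a\Big(1+\frac{a^2-1}{2a^2-1}\,W\Big(\frac{1-2a^2}{a^2-1}\,e^{-1}\Big)\Big),$$ where for $a=1$ the right-hand side is understood as its limit as $a\to1^-$, i.e. as $1$.
   Context: $\mathbb{D}$ is the open unit disk and $\|g\|_\infty=\sup_{z\in\mathbb{D}}|g(z)|$. $\mathcal{H}_1(\mathbb{D})$ is the set of analytic functions on $\mathbb{D}$ of the form $f(z)=\sum_{n\ge1}a_nz^n$. The majorant series is $M_rf=\sum_n|a_n|r^n$. $\partial f=f'$ and $id_1$ is the identity operator on $\mathcal{H}_1(\mathbb{D})$. $W$ is the Lambert function, the inverse of $g(w)=we^w$, defined on $[-1/e,\infty)$, with the branch chosen so that $W(x)\ge-1$. The Bohr radius with initial coefficient $a$, denoted $R_{\partial\to id_1}(a)$, is the maximal $R\in[0,\infty)$ such that for every $f=\sum_{n\ge1}a_nz^n\in\mathcal{H}_1(\mathbb{D})$ with $\|f'\|_\infty\le1$ and $|a_1|=a$ one has $\sum_{n\ge1}|a_n|r^n\le1$ for all $0\le r\le R$. *)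

(* Defs.v *)
From Stdlib Require Import Reals Lra ClassicalEpsilon.
From Coquelicot Require Import Coquelicot.
Open Scope R_scope.

(** Principal real branch of the Lambert function.  The value is meaningful only
    for [x >= - exp (-1)], where [LambertW_spec] and [LambertW_unique] apply. *)
Definition LambertW (x : R) : R :=
  epsilon (inhabits 0) (fun w => -1 <= w /\ w * exp w = x).

Lemma mul_exp_lt (v w : R) : -1 <= v -> v < w -> v * exp v < w * exp w.
Proof.
intros Hv Hvw.
replace (exp v) with (exp (v - w) * exp w)
  by (rewrite <- exp_plus; f_equal; ring).
rewrite <- Rmult_assoc.
apply Rmult_lt_compat_r; [apply exp_pos|].
assert (H1 : 1 + (v - w) < exp (v - w)) by (apply exp_ineq1; lra).
assert (H2 : exp (v - w) < 1) by (rewrite <- exp_0; apply exp_increasing; lra).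
destruct (Rle_lt_dec 0 v); nra.
Qed.

Lemma LambertW_spec (x : R) :
  - exp (-1) <= x -> -1 <= LambertW x /\ LambertW x * exp (LambertW x) = x.
Proof.
intros Hx; unfold LambertW; apply epsilon_spec.
set (b := Rabs x).
assert (Hb : 0 <= b) by apply Rabs_pos.
assert (Hxb : x <= b) by apply Rle_abs.
assert (Heb : 1 <= exp b) by (pose proof (exp_ineq1_le b); lra).
destruct (IVT_gen (fun w => w * exp w) (-1) b x) as [w [Hw Hwx]].
- intros w; apply derivable_continuous_pt.
  apply derivable_pt_mult; [apply derivable_pt_id | apply derivable_pt_exp].
- assert (H : -1 * exp (-1) <= x <= b * exp b) by (split; nra).
  rewrite Rmin_left, Rmax_right; lra.
- exists w; split; [|exact Hwx].
  rewrite Rmin_left in Hw; lra.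
Qed.

Lemma LambertW_unique (w : R) : -1 <= w -> LambertW (w * exp w) = w.
Proof.
intros Hw.
assert (Hx : - exp (-1) <= w * exp w).
{ destruct (Rle_lt_or_eq_dec _ _ Hw) as [H | <-]; [|lra].
  pose proof (mul_exp_lt (-1) w (Rle_refl _) H); lra. }
destruct (LambertW_spec _ Hx) as [H1 H2].
destruct (Rtotal_order (LambertW (w * exp w)) w) as [H | [H | H]]; auto.
- pose proof (mul_exp_lt _ _ H1 H); lra.
- pose proof (mul_exp_lt _ _ Hw H); lra.
Qed.

(** [f] belongs to H_1(D), with Taylor coefficients [c] at 0.  Values of [f]
    outside the open unit disk are irrelevant; convergence of the power series on
    the whole disk makes [f] analytic there. *)
Definition H1_expansion (f : C -> C) (c : nat -> C) : Prop :=
  c 0%nat = 0%C /\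
  forall z : C, Cmod z < 1 ->
    @is_pseries C_AbsRing (AbsRing_NormedModule C_AbsRing) c z (f z).

Definition disk_sup_norm (g : C -> C) : Rbar :=
  Lub_Rbar (fun x => exists z : C, Cmod z < 1 /\ x = Cmod (g z)).

(** For [0 <= r] the partial sums are nondecreasing, so [Lim_seq] is the sum of
    the series in [[0, +oo]], equal to [p_infty] exactly when it diverges. *)
Definition majorant (c : nat -> C) (r : R) : Rbar :=
  Lim_seq (sum_n (fun n => Cmod (c n) * r ^ n)).

Definition bohr_admissible (a rho : R) : Prop :=
  0 <= rho /\
  forall (f : C -> C) (c : nat -> C),
    H1_expansion f c ->
    Rbar_le (disk_sup_norm (C_derive f)) 1 ->
    Cmod (c 1%nat) = a ->
    forall r : R, 0 <= r <= rho -> Rbar_le (majorant c r) 1.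

Definition is_bohr_radius (a rho : R) : Prop :=
  bohr_admissible a rho /\
  forall rho' : R, bohr_admissible a rho' -> rho' <= rho.

Definition a0 : R := sqrt (1 + 1 / 2 * LambertW (- (2 / exp 2))).

Definition bohr_formula (a : R) : R :=
  1 / a * (1 + (a ^ 2 - 1) / (2 * a ^ 2 - 1)
               * LambertW ((1 - 2 * a ^ 2) / (a ^ 2 - 1) * exp (-1))).

(** [bohr_formula] involves a division by [0] at [a = 1]; there it is replaced by
    the value [1] of its limit from the left. *)
Definition bohr_value (a : R) : R :=
  if Req_EM_T a 1 then 1 else bohr_formula a.

(* Main.v *)
Require Import Defs.
From Stdlib Require Import Reals Lra Lia ClassicalEpsilon.
From Coquelicot Require Import Coquelicot.
Open Scope R_scope.

(** Write [g = f'] and [b n] for the Taylor coefficients of [g], so that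
    [|b 0| = a], [|g| <= 1] on the disk, and the majorant series of [f] at [r] is
    the integral from [0] to [r] of the sum of the [|b n| t ^ n].  Everything
    rests on the inequality of Bombieri for bounded functions,

      sum of [|b n| t ^ n]  <=  a + (1 - a^2) t / (1 - a t)    for [0 <= t <= a],

    which the Moebius map [(a - z) / (1 - a z)] turns into an equality.
    Integrating, the majorant series of [f] is at most

      Phi_a(r) = (2 a^2 - 1) / a * r - (1 - a^2) / a^2 * ln (1 - a r)

    ([extremal_primitive]), with equality for the primitive of the Moebius map.
    Hence for [a < 1] the Bohr radius is the root of [Phi_a(r) = 1], as long as that
    root does not exceed [a].  With [u = 1 - a r] and [k = (2 a^2 - 1) / (1 - a^2)] the
    equation becomes [ln u + k u = -1], which the Lambert function solves, and the
    condition on the root amounts to [Phi_a(a) >= 1], that is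
    [(1 - a^2) exp (2 a^2) <= 1]; equality in the latter defines [a0].
    For [a = 1] only [f(z) = c z] with [|c| = 1] remains, and the radius is 1.

    The inequality of Bombieri is reached without the Schwarz lemma or the maximum
    principle.  If [|g| <= 1] then [|g (1 + c z^M)| <= |1 + c z^M|] on the disk,
    and Parseval on circles turns this into an inequality between sums of squares
    of coefficients ([hardy_norm_le]).  For the best constant [c] it reads

      |b_M|^2  <=  (1 - a^2) (1 - sum of [|b n|^2] over [n < M])

    ([schur_coefficient_bound]).  An Abel summation with the weights [rho ^ n],
    [rho = t / a], followed by a weighted arithmetic-geometric mean inequality,
    gives the bound ([bombieri_bound]); [t <= a] is what makes the weights
    nonincreasing.

    For the converse one needs that the primitive of the Moebius map, given by its
    power series, has the Moebius map as its complex derivative; the same termwise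
    differentiation ([disk_expansion_derive]) identifies the coefficients of
    [f'] in the upper bound. *)

(** * Finite sums and series of complex numbers *)

(** Convergence in the normed module carried by the absolute ring [C], the one
    used by [H1_expansion].  [C_NormedModule] has the same norm but a uniform
    structure defined by other balls; [locally_C] relates the two. *)
Notation is_Cseries :=
  (@is_series C_AbsRing (AbsRing_NormedModule C_AbsRing)) (only parsing).

(** A constant of type [C]: the type of a bare [sum_n] is the carrier of a monoid,
    which [ring] and [field] do not recognise as [C]. *)
Definition Csum (u : nat -> C) (n : nat) : C := @sum_n C_AbelianMonoid u n.

Lemma Csum_ext (u v : nat -> C) (n : nat) :
  (forall k, u k = v k) -> Csum u n = Csum v n.
Proof. exact (sum_n_ext (G := C_AbelianMonoid) u v n). Qed.

Lemma Csum_Sn (u : nat -> C) (n : nat) :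
  Csum u (S n) = (Csum u n + u (S n))%C.
Proof. exact (sum_Sn u n). Qed.

Lemma Csum_0 (u : nat -> C) : Csum u 0 = u 0%nat.
Proof. exact (sum_O u). Qed.

Lemma Rsum_Sn (u : nat -> R) (n : nat) : sum_n u (S n) = sum_n u n + u (S n).
Proof. exact (sum_Sn u n). Qed.

Lemma Rsum_0 (u : nat -> R) : sum_n u 0 = u 0%nat.
Proof. exact (sum_O u). Qed.

Lemma Csum_mult_l (a : C) (u : nat -> C) (n : nat) :
  Csum (fun k => (a * u k)%C) n = (a * Csum u n)%C.
Proof. exact (sum_n_mult_l (K := C_Ring) a u n). Qed.

Lemma Csum_plus (u v : nat -> C) (n : nat) :
  Csum (fun k => (u k + v k)%C) n = (Csum u n + Csum v n)%C.
Proof. exact (sum_n_plus (G := C_AbelianMonoid) u v n). Qed.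

Lemma Csum_conj (u : nat -> C) (n : nat) :
  Csum (fun k => Cconj (u k)) n = Cconj (Csum u n).
Proof.
induction n as [|n IH]; [now rewrite !Csum_0|].
now rewrite !Csum_Sn, Cplus_conj, IH.
Qed.

Lemma Csum_Re (u : nat -> C) (n : nat) :
  Re (Csum u n) = sum_n (fun k => Re (u k)) n.
Proof.
induction n as [|n IH]; [now rewrite Csum_0, Rsum_0|].
now rewrite Csum_Sn, Rsum_Sn, <- IH.
Qed.

Lemma Rsum_mult_l (a : R) (u : nat -> R) (n : nat) :
  sum_n (fun k => a * u k) n = a * sum_n u n.
Proof. exact (sum_n_mult_l (K := R_Ring) a u n). Qed.

Lemma Rsum_plus (u v : nat -> R) (n : nat) :
  sum_n (fun k => u k + v k) n = sum_n u n + sum_n v n.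
Proof. exact (sum_n_plus (G := R_AbelianMonoid) u v n). Qed.

Lemma Rsum_le (u v : nat -> R) (n : nat) :
  (forall k, (k <= n)%nat -> u k <= v k) -> sum_n u n <= sum_n v n.
Proof.
induction n as [|n IH]; intros H; [rewrite !Rsum_0; auto|].
rewrite !Rsum_Sn; apply Rplus_le_compat; auto.
Qed.

Lemma Rsum_ge_0 (u : nat -> R) (n : nat) :
  (forall k, 0 <= u k) -> 0 <= sum_n u n.
Proof.
intros H; induction n as [|n IH]; [rewrite Rsum_0; apply H|].
rewrite Rsum_Sn; specialize (H (S n)); lra.
Qed.

Lemma Rsum_const (a : R) (n : nat) : sum_n (fun _ => a) n = INR (S n) * a.
Proof. exact (sum_n_const n a). Qed.

Lemma Csum_head (u : nat -> C) (m : nat) :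
  (forall k, (0 < k <= m)%nat -> u k = 0) -> Csum u m = u 0%nat.
Proof.
induction m as [|m IH]; intros H; [apply Csum_0|].
rewrite Csum_Sn, (H (S m)), IH by (intros; lia || (apply H; lia)).
ring.
Qed.

Lemma Rsum_head (u : nat -> R) (m : nat) :
  (forall k, (0 < k <= m)%nat -> u k = 0) -> sum_n u m = u 0%nat :> R.
Proof.
induction m as [|m IH]; intros H; [apply Rsum_0|].
rewrite Rsum_Sn, (H (S m)), IH by (intros; lia || (apply H; lia)).
ring.
Qed.

Lemma Rsum_ext (u v : nat -> R) (n : nat) :
  (forall k, (k <= n)%nat -> u k = v k) -> sum_n u n = sum_n v n.
Proof. exact (sum_n_ext_loc (G := R_AbelianMonoid) u v n). Qed.

Lemma Rsum_shift (u : nat -> R) (n : nat) :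
  sum_n u (S n) = u 0%nat + sum_n (fun k => u (S k)) n :> R.
Proof.
induction n as [|n IH]; [now rewrite Rsum_Sn, !Rsum_0|].
rewrite Rsum_Sn, IH, Rsum_Sn; ring.
Qed.

Lemma is_pseries_C (c : nat -> C) (z l : C) :
  @is_pseries C_AbsRing (AbsRing_NormedModule C_AbsRing) c z l <->
  is_Cseries (fun n => (c n * z ^ n)%C) l.
Proof.
unfold is_pseries; split; apply is_series_ext; intros n;
  exact (Cmult_comm _ _).
Qed.

Lemma Rgeom_sum (x : R) (n : nat) :
  (1 - x) * sum_n (fun k => x ^ k) n = 1 - x ^ S n.
Proof.
induction n as [|n IH]; [rewrite Rsum_0; simpl; ring|].
rewrite Rsum_Sn, Rmult_plus_distr_l, IH; simpl; ring.
Qed.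

Lemma Cgeom_sum (q : C) (n : nat) :
  ((1 - q) * Csum (fun k => (q ^ k)%C) n = 1 - q ^ S n)%C.
Proof.
induction n as [|n IH]; [rewrite Csum_0; simpl; ring|].
rewrite Csum_Sn, Cmult_plus_distr_l, IH; simpl; ring.
Qed.

Lemma one_minus_neq_0 (q : C) : Cmod q < 1 -> (1 - q)%C <> RtoC 0.
Proof.
intros Hq E.
assert (E' : q = RtoC 1) by (rewrite <- (Cplus_0_l q), <- E; ring).
rewrite E', Cmod_1 in Hq; lra.
Qed.

Lemma is_Cseries_lim (u : nat -> C) (l : C) :
  is_Cseries u l <-> is_lim_seq (fun n => Cmod (Csum u n - l)) 0.
Proof.
split.
- intros H.
  apply is_lim_seq_spec; intros eps.
  destruct (proj1 (filterlim_locally (U := AbsRing_UniformSpace C_AbsRing) _ _) H eps) as [N HN].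
  exists N; intros n Hn; specialize (HN n Hn).
  rewrite Rminus_0_r, Rabs_pos_eq by apply Cmod_ge_0. exact HN.
- intros H; apply is_lim_seq_spec in H.
  apply (proj2 (filterlim_locally (U := AbsRing_UniformSpace C_AbsRing) _ _)).
  intros eps; destruct (H eps) as [N HN].
  exists N; intros n Hn; specialize (HN n Hn).
  rewrite Rminus_0_r, Rabs_pos_eq in HN by apply Cmod_ge_0. exact HN.
Qed.

Lemma ex_Cseries_geom (u : nat -> C) (B x : R) :
  0 <= x < 1 -> (forall n, Cmod (u n) <= B * x ^ n) -> exists l, is_Cseries u l.
Proof.
intros Hx Hu.
assert (H : @ex_series C_AbsRing C_CompleteNormedModule u).
{ apply ex_series_le with (b := fun n => B * x ^ n).
  - exact Hu.
  - apply (ex_series_scal (V := R_NormedModule) B).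
    apply ex_series_geom. rewrite Rabs_pos_eq; lra. }
destruct H as [l Hl]; exists l.
intros P HP; apply Hl.
exact (proj2 (locally_C l P) HP).
Qed.

(** Every error term below is the tail of a series dominated by a geometric one. *)
Lemma Cseries_tail (u : nat -> C) (l : C) (B x : R) (L : nat) :
  0 <= x < 1 -> (forall n, Cmod (u n) <= B * x ^ n) -> is_Cseries u l ->
  Cmod (l - Csum u L) <= B * x ^ S L / (1 - x).
Proof.
intros Hx Hu Hl.
assert (HB : 0 <= B).
{ apply Rle_trans with (1 := Cmod_ge_0 (u 0%nat)).
  apply Rle_trans with (1 := Hu 0%nat); simpl; lra. }
assert (Hpart : forall d, Cmod (Csum u (d + L) - Csum u L)
                  <= B * x ^ S L * (1 - x ^ d) / (1 - x)).
{ induction d as [|d IH].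
  - simpl; replace (Csum u L - Csum u L)%C with (RtoC 0) by ring.
    rewrite Cmod_0; right; field; lra.
  - change (S d + L)%nat with (S (d + L)); rewrite Csum_Sn.
    replace (Csum u (d + L) + u (S (d + L)) - Csum u L)%C
      with ((Csum u (d + L) - Csum u L) + u (S (d + L)))%C by ring.
    apply Rle_trans with (1 := Cmod_triangle _ _).
    apply Rle_trans with (1 := Rplus_le_compat _ _ _ _ IH (Hu _)).
    right; replace (S (d + L)) with (d + S L)%nat by lia.
    rewrite pow_add; simpl; field; lra. }
apply le_epsilon; intros eps Heps.
apply is_Cseries_lim, is_lim_seq_spec in Hl.
destruct (Hl (mkposreal eps Heps)) as [N HN].
specialize (HN (N + L)%nat (Nat.le_add_r N L)); simpl in HN.
rewrite Rminus_0_r, Rabs_pos_eq in HN by apply Cmod_ge_0.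
replace (l - Csum u L)%C
  with ((Csum u (N + L) - Csum u L) + - (Csum u (N + L) - l))%C by ring.
apply Rle_trans with (1 := Cmod_triangle _ _).
rewrite Cmod_opp; apply Rplus_le_compat; [|lra].
apply Rle_trans with (1 := Hpart N).
apply Rmult_le_compat_r; [left; apply Rinv_0_lt_compat; lra|].
rewrite <- (Rmult_1_r (B * x ^ S L)) at 2.
apply Rmult_le_compat_l; [apply Rmult_le_pos; auto; apply pow_le; lra|].
pose proof (pow_le x N (proj1 Hx)); lra.
Qed.

Lemma Cseries_geom_bound (u : nat -> C) (l : C) (B x : R) :
  0 <= x < 1 -> (forall n, Cmod (u n) <= B * x ^ n) -> is_Cseries u l ->
  Cmod l <= B / (1 - x).
Proof.
intros Hx Hu Hl.
pose proof (Cseries_tail u l B x 0 Hx Hu Hl) as H.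
rewrite Csum_0 in H; specialize (Hu 0%nat).
replace l with ((l - u 0%nat) + u 0%nat)%C by ring.
apply Rle_trans with (1 := Cmod_triangle _ _).
replace (B / (1 - x)) with (B * x ^ 1 / (1 - x) + B * x ^ 0) by (simpl; field; lra).
lra.
Qed.

Lemma Cseries_terms_bounded (u : nat -> C) (l : C) :
  is_Cseries u l -> exists B, forall n, Cmod (u n) <= B.
Proof.
intros Hl.
destruct (filterlim_bounded (V := AbsRing_NormedModule C_AbsRing) (Csum u)
            (ex_intro _ l Hl)) as [M HM].
change (forall n, Cmod (Csum u n) <= M) in HM.
exists (2 * M); intros [|n].
- specialize (HM 0%nat); rewrite Csum_0 in HM.
  pose proof (Cmod_ge_0 (u 0%nat)); lra.
- pose proof (HM n); pose proof (HM (S n)) as H1; rewrite Csum_Sn in H1.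
  replace (u (S n)) with ((Csum u n + u (S n)) + - Csum u n)%C by ring.
  apply Rle_trans with (1 := Cmod_triangle _ _); rewrite Cmod_opp; lra.
Qed.

Lemma Cseries_unique (u : nat -> C) (l l' : C) :
  is_Cseries u l -> is_Cseries u l' -> l = l'.
Proof.
exact (filterlim_locally_unique (V := AbsRing_NormedModule C_AbsRing) _ l l').
Qed.

(** * Power series on the unit disk and their derivatives *)

Definition disk_expansion (c : nat -> C) (f : C -> C) : Prop :=
  forall z : C, Cmod z < 1 -> is_Cseries (fun n => (c n * z ^ n)%C) (f z).

Lemma disk_expansion_coef_bound (c : nat -> C) (f : C -> C) (t : R) :
  disk_expansion c f -> 0 <= t < 1 ->
  exists B, forall n, Cmod (c n) * t ^ n <= B.
Proof.
intros Hf Ht.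
assert (Habs : Cmod t = t) by (rewrite Cmod_R; apply Rabs_pos_eq; lra).
assert (Hm : Cmod t < 1) by lra.
destruct (Cseries_terms_bounded _ _ (Hf t Hm)) as [B HB].
exists B; intros n; specialize (HB n).
now rewrite Cmod_mult, Cmod_pow, Habs in HB.
Qed.

(** A factor [n] costs no more than an enlarged ratio.  The exact constant
    [/ (q - p)] is the sum of the geometric series of ratio [p / q], up to a power
    of [q], and makes the induction close. *)
Lemma nat_mul_pow_le (p q : R) (n : nat) :
  0 <= p < q -> INR (S n) * p ^ n <= q ^ S n / (q - p).
Proof.
intros Hpq; induction n as [|n IH].
- simpl; apply Rmult_le_reg_r with (q - p); [lra|]; field_simplify; lra.
- rewrite S_INR, Rmult_plus_distr_r.
  replace (q ^ S (S n) / (q - p)) with (p * (q ^ S n / (q - p)) + q ^ S n)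
    by (simpl; field; lra).
  apply Rplus_le_compat.
  + replace (INR (S n) * p ^ S n) with (p * (INR (S n) * p ^ n)) by (simpl; ring).
    apply Rmult_le_compat_l; lra.
  + rewrite Rmult_1_l; apply pow_incr; lra.
Qed.

(** The remainder satisfies [A (n+1) = w * A n + n * z^(n-1) * (w - z)^2], so the
    bound follows from [nat_mul_pow_le] by induction.  It is quadratic in [w - z]
    with a geometric dependence on [n], which makes it summable against the
    coefficients of a power series. *)
Lemma pow_linear_remainder (w z : C) (p q : R) (n : nat) :
  Cmod w <= p -> Cmod z <= p -> 0 <= p < q ->
  Cmod (w ^ n - z ^ n - INR n * z ^ pred n * (w - z))
    <= Cmod (w - z) ^ 2 * (q ^ n / (q - p) ^ 2).
Proof.
intros Hw Hz Hpq.
assert (Hq : 0 < / (q - p)) by (apply Rinv_0_lt_compat; lra).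
assert (Hh := pow2_ge_0 (Cmod (w - z))).
induction n as [|n IH].
- simpl pred; simpl INR.
  replace (w ^ 0 - z ^ 0 - RtoC 0 * z ^ 0 * (w - z))%C with (RtoC 0)
    by (simpl; ring).
  rewrite Cmod_0; apply Rmult_le_pos; auto.
  apply Rmult_le_pos; [simpl; lra|].
  left; apply Rinv_0_lt_compat, pow_lt; lra.
- replace (w ^ S n - z ^ S n - INR (S n) * z ^ pred (S n) * (w - z))%C
    with (w * (w ^ n - z ^ n - INR n * z ^ pred n * (w - z))
          + INR n * z ^ pred n * ((w - z) * (w - z)))%C.
  2: { rewrite S_INR, RtoC_plus; destruct n as [|m]; simpl pred.
       - simpl; ring.
       - rewrite !Cpow_S; ring. }
  apply Rle_trans with (1 := Cmod_triangle _ _).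
  replace (Cmod (w - z) ^ 2 * (q ^ S n / (q - p) ^ 2))
    with (p * (Cmod (w - z) ^ 2 * (q ^ n / (q - p) ^ 2))
          + q ^ n / (q - p) * Cmod (w - z) ^ 2) by (simpl; field; lra).
  rewrite !Cmod_mult; apply Rplus_le_compat.
  + apply Rmult_le_compat; auto using Cmod_ge_0.
  + replace (Cmod (w - z) * Cmod (w - z)) with (Cmod (w - z) ^ 2) by ring.
    apply Rmult_le_compat_r; [exact Hh|].
    rewrite Cmod_R, Rabs_pos_eq, Cmod_pow by apply pos_INR.
    destruct n as [|m]; simpl pred.
    * simpl; rewrite Rmult_0_l; apply Rmult_le_pos; lra.
    * apply Rle_trans with (2 := nat_mul_pow_le p q m Hpq).
      apply Rmult_le_compat_l; [apply pos_INR|].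
      apply pow_incr; split; auto using Cmod_ge_0.
Qed.

Lemma Cseries_shift (u : nat -> C) (l : C) :
  is_Cseries u l ->
  is_Cseries (fun n => match n with O => RtoC 0 | S m => u m end) l.
Proof.
intros Hl.
apply (is_series_decr_1 (V := AbsRing_NormedModule C_AbsRing)).
match goal with |- is_series _ ?x => replace x with l; [exact Hl|] end.
change (l = (l + - 0)%C); ring.
Qed.

(** For some [t] beyond [Cmod z] the numbers [Cmod (c n) * t ^ n] are bounded; by
    [pow_linear_remainder] the linear remainder of [f] at [z] is then
    [O(|w - z|^2)].  The radii [Cmod z < p < q < t < 1] leave room for [w]
    around [z], for the factor [n], and for a convergent comparison series. *)
Lemma disk_expansion_derive (c : nat -> C) (f : C -> C) (z : C) :
  disk_expansion c f -> Cmod z < 1 ->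
  is_Cseries (fun n => (INR (S n) * c (S n) * z ^ n)%C) (C_derive f z).
Proof.
intros Hf Hz.
assert (Hr := Cmod_ge_0 z).
set (p := (3 * Cmod z + 1) / 4); set (q := (Cmod z + 1) / 2);
  set (t := (Cmod z + 3) / 4).
assert (Hp : Cmod z < p < q) by (unfold p, q; lra).
assert (Hq : q < t < 1) by (unfold q, t; lra).
set (x := q / t).
assert (Hxt : x * t = q) by (unfold x; field; lra).
assert (Hx : 0 <= x < 1) by (split; nra).
destruct (disk_expansion_coef_bound c f t Hf) as [B HB]; [lra|].
assert (HB0 : 0 <= B).
{ apply Rle_trans with (2 := HB 0%nat).
  apply Rmult_le_pos; [apply Cmod_ge_0|simpl; lra]. }
assert (Hc : forall n, Cmod (c n) * q ^ n <= B * x ^ n).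
{ intros n; rewrite <- Hxt, Rpow_mult_distr.
  rewrite (Rmult_comm B), (Rmult_comm (x ^ n)), <- Rmult_assoc, Rmult_comm.
  apply Rmult_le_compat_l; [apply pow_le; lra|apply HB]. }
destruct (ex_Cseries_geom (fun n => (INR (S n) * c (S n) * z ^ n)%C)
            (B * x / (q - p)) x Hx) as [l Hl].
{ intros n.
  rewrite !Cmod_mult, Cmod_R, Rabs_pos_eq, Cmod_pow by apply pos_INR.
  apply Rle_trans with (Cmod (c (S n)) * (q ^ S n / (q - p))).
  - rewrite (Rmult_comm (INR _)), Rmult_assoc.
    apply Rmult_le_compat_l; [apply Cmod_ge_0|].
    apply Rle_trans with (2 := nat_mul_pow_le p q n ltac:(lra)).
    apply Rmult_le_compat_l; [apply pos_INR|apply pow_incr; lra].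
  - replace (B * x / (q - p) * x ^ n) with (B * x ^ S n / (q - p))
      by (simpl; field; lra).
    unfold Rdiv; rewrite <- Rmult_assoc.
    apply Rmult_le_compat_r; [left; apply Rinv_0_lt_compat; lra|apply Hc]. }
enough (Hd : is_derive (V := C_NormedModule) f z l)
  by now rewrite (is_C_derive_unique f z l Hd).
set (K := B / (q - p) ^ 2 / (1 - x)).
assert (HK : 0 <= K).
{ unfold K; apply Rmult_le_pos; [apply Rmult_le_pos; [exact HB0|]|];
    left; apply Rinv_0_lt_compat; [apply pow_lt|]; lra. }
assert (Hrem : forall w, Cmod w <= p ->
          Cmod (f w - f z - l * (w - z)) <= K * Cmod (w - z) ^ 2).
{ intros w Hw.
  assert (Hs : is_Cseries
            (fun n => (c n * (w ^ n - z ^ n - INR n * z ^ pred n * (w - z)))%C)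
            (f w - f z - l * (w - z))%C).
  { pose proof (Cseries_shift _ _ Hl) as Hl'.
    pose proof (is_series_minus _ _ _ _
      (is_series_minus _ _ _ _ (Hf w ltac:(lra)) (Hf z Hz))
      (is_series_scal (w - z)%C _ _ Hl')) as Hs.
    match type of Hs with is_series _ ?y =>
      replace (f w - f z - l * (w - z))%C with y end.
    - revert Hs; apply is_series_ext; intros [|n].
      + change (c 0%nat * w ^ 0 + - (c 0%nat * z ^ 0) + - ((w - z) * 0)
          = c 0%nat * (w ^ 0 - z ^ 0 - INR 0 * z ^ 0 * (w - z)))%C.
        simpl; ring.
      + change (c (S n) * w ^ S n + - (c (S n) * z ^ S n)
           + - ((w - z) * (INR (S n) * c (S n) * z ^ n))
          = c (S n) * (w ^ S n - z ^ S n - INR (S n) * z ^ n * (w - z)))%C.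
        ring.
    - change (f w + - f z + - ((w - z) * l) = f w - f z - l * (w - z))%C.
      ring. }
  replace (K * Cmod (w - z) ^ 2)
    with (Cmod (w - z) ^ 2 * (B / (q - p) ^ 2) / (1 - x))
    by (unfold K; field; lra).
  apply (Cseries_geom_bound _ _ _ x Hx) with (2 := Hs); intros n.
  rewrite Cmod_mult.
  apply Rle_trans with
    (Cmod (c n) * (Cmod (w - z) ^ 2 * (q ^ n / (q - p) ^ 2))).
  - apply Rmult_le_compat_l; [apply Cmod_ge_0|].
    apply pow_linear_remainder; lra.
  - replace (Cmod (c n) * (Cmod (w - z) ^ 2 * (q ^ n / (q - p) ^ 2)))
      with (Cmod (w - z) ^ 2 * / (q - p) ^ 2 * (Cmod (c n) * q ^ n))
      by (field; lra).
    replace (Cmod (w - z) ^ 2 * (B / (q - p) ^ 2) * x ^ n)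
      with (Cmod (w - z) ^ 2 * / (q - p) ^ 2 * (B * x ^ n)) by (field; lra).
    apply Rmult_le_compat_l; [|apply Hc].
    apply Rmult_le_pos; [apply pow2_ge_0|].
    left; apply Rinv_0_lt_compat, pow_lt; lra. }
split; [apply is_linear_scal_l|].
intros z' Hz'.
apply (is_filter_lim_locally_unique (V := AbsRing_NormedModule C_AbsRing)) in Hz'.
subst z'; intros eps.
assert (Hd : 0 < Rmin (p - Cmod z) (eps / (K + 1))).
{ apply Rmin_pos; [lra|]. apply Rdiv_lt_0_compat; [apply eps|lra]. }
exists (mkposreal _ Hd); intros w Hw.
change (Cmod (w - z) < Rmin (p - Cmod z) (eps / (K + 1))) in Hw.
change (Cmod (f w - f z - (w - z) * l) <= eps * Cmod (w - z)).
pose proof (Rlt_le_trans _ _ _ Hw (Rmin_l _ _)) as Hw1.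
pose proof (Rlt_le_trans _ _ _ Hw (Rmin_r _ _)) as Hw2.
rewrite (Cmult_comm (w - z) l).
assert (Hwp : Cmod w <= p).
{ replace w with (z + (w - z))%C by ring.
  apply Rle_trans with (1 := Cmod_triangle _ _); lra. }
apply Rle_trans with (1 := Hrem w Hwp).
rewrite <- Rsqr_pow2; unfold Rsqr; rewrite <- Rmult_assoc.
apply Rmult_le_compat_r; [apply Cmod_ge_0|].
apply Rle_trans with ((K + 1) * (eps / (K + 1))); [|right; field; lra].
apply Rmult_le_compat; try lra; apply Cmod_ge_0.
Qed.

(** * Parseval on circles *)

Definition cis (x : R) : C := (cos x, sin x).

Lemma cis_pow (x : R) (n : nat) : (cis x ^ n)%C = cis (INR n * x).
Proof.
induction n as [|n IH].
- simpl; unfold cis; rewrite Rmult_0_l, cos_0, sin_0; reflexivity.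
- rewrite Cpow_S, IH, S_INR, Rmult_plus_distr_r, Rmult_1_l.
  unfold cis, Cmult; simpl; rewrite cos_plus, sin_plus.
  f_equal; ring.
Qed.

Lemma Cmod_cis (x : R) : Cmod (cis x) = 1.
Proof.
transitivity (sqrt 1); [|exact sqrt_1].
unfold Cmod, cis; f_equal; simpl.
transitivity (Rsqr (sin x) + Rsqr (cos x)); [unfold Rsqr; ring|].
apply sin2_cos2.
Qed.

Lemma cis_2PI : cis (2 * PI) = 1.
Proof. unfold cis; rewrite cos_2PI, sin_2PI; reflexivity. Qed.

Lemma cis_neq_1 (x : R) : 0 < x < 2 * PI -> cis x <> 1.
Proof.
intros Hx H; apply (f_equal fst) in H; simpl in H.
replace x with (2 * (x / 2)) in H by field.
rewrite cos_2a_sin in H.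
assert (0 < sin (x / 2)) by (apply sin_gt_0; lra).
nra.
Qed.

(** The order is [k + 1], the number of terms of [sum_n _ k]. *)
Definition unity_root (k : nat) : C := cis (2 * PI / INR (S k)).

Lemma Cmod_unity_root_pow (k j : nat) : Cmod (unity_root k ^ j) = 1.
Proof. rewrite Cmod_pow; unfold unity_root; rewrite Cmod_cis; apply pow1. Qed.

Lemma unity_root_sum (k m : nat) :
  (0 < m <= k)%nat -> Csum (fun j => ((unity_root k ^ j) ^ m)%C) k = RtoC 0.
Proof.
intros Hm.
assert (Hk : 0 < INR (S k)) by (apply lt_0_INR; lia).
assert (Hm' : 0 < INR m < INR (S k)) by (split; apply lt_INR || apply lt_0_INR; lia).
assert (HPI := PI_RGT_0).
set (q := (unity_root k ^ m)%C).
assert (Hq1 : (1 - q)%C <> 0).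
{ unfold q, unity_root; rewrite cis_pow; intros H.
  apply (cis_neq_1 (INR m * (2 * PI / INR (S k)))).
  - replace (INR m * (2 * PI / INR (S k))) with (2 * PI * (INR m / INR (S k)))
      by (field; lra).
    assert (0 < INR m / INR (S k) < 1); [|nra].
    split; [apply Rdiv_lt_0_compat; lra|].
    apply Rmult_lt_reg_r with (INR (S k)); [lra|]; field_simplify; lra.
  - replace (cis (INR m * (2 * PI / INR (S k))))
      with (1 - (1 - cis (INR m * (2 * PI / INR (S k)))))%C by ring.
    rewrite H; ring. }
assert (Hq : (q ^ S k)%C = 1).
{ unfold q; rewrite <- Cpow_mult_r, Nat.mul_comm, Cpow_mult_r.
  unfold unity_root; rewrite cis_pow.
  replace (INR (S k) * (2 * PI / INR (S k))) with (2 * PI) by (field; lra).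
  now rewrite cis_2PI, Cpow_1_l. }
rewrite (Csum_ext _ (fun j => (q ^ j)%C)).
2: { intros j; unfold q; rewrite <- !Cpow_mult_r; f_equal; lia. }
pose proof (Cgeom_sum q k) as H; rewrite Hq in H.
replace (1 - 1)%C with (RtoC 0) in H by ring.
rewrite <- (Cmult_1_l (Csum _ k)), <- (Cinv_l (1 - q)%C Hq1), <- Cmult_assoc, H.
ring.
Qed.

Definition Cpoly (p : nat -> C) (N : nat) (z : C) : C :=
  Csum (fun n => (p n * z ^ n)%C) N.

Lemma Cpoly_S (p : nat -> C) (N : nat) (z : C) :
  Cpoly p (S N) z = (Cpoly p N z + p (S N) * z ^ S N)%C.
Proof. apply Csum_Sn. Qed.

(** All exponents of the polynomial differ from [m] by less than the order of the
    root of unity. *)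
Lemma Cpoly_orthogonal (p : nat -> C) (N m k : nat) :
  (N < m <= k)%nat ->
  Csum (fun j => (Cpoly p N (unity_root k ^ j)
                  * Cconj ((unity_root k ^ j) ^ m))%C) k = RtoC 0.
Proof.
assert (Hmono : forall n, (n < m <= k)%nat ->
  Csum (fun j => (p n * (unity_root k ^ j) ^ n
                  * Cconj ((unity_root k ^ j) ^ m))%C) k = RtoC 0).
{ intros n Hn.
  rewrite (Csum_ext _
    (fun j => (p n * Cconj ((unity_root k ^ j) ^ (m - n)))%C)).
  - rewrite Csum_mult_l.
    rewrite (Csum_conj (fun j => ((unity_root k ^ j) ^ (m - n))%C)).
    rewrite unity_root_sum by lia.
    unfold Cconj; simpl; rewrite Ropp_0; apply Cmult_0_r.
  - intros j; set (w := (unity_root k ^ j)%C).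
    assert (Hw : (w ^ n * Cconj (w ^ n))%C = 1).
    { rewrite <- Cmod2_conj, Cmod_pow; unfold w.
      now rewrite Cmod_unity_root_pow, !pow1. }
    replace m with (n + (m - n))%nat at 1 by lia.
    rewrite Cpow_add_r, Cmult_conj.
    transitivity (p n * (w ^ n * Cconj (w ^ n)) * Cconj (w ^ (m - n)))%C;
      [ring|rewrite Hw; ring]. }
induction N as [|N IH]; intros HN.
- rewrite <- (Hmono 0%nat) by lia.
  apply Csum_ext; intros j.
  unfold Cpoly; now rewrite Csum_0.
- transitivity (0 + 0)%C; [|ring].
  rewrite <- IH at 1 by lia; rewrite <- (Hmono (S N)) by lia.
  rewrite <- Csum_plus.
  apply Csum_ext; intros j.
  rewrite Cpoly_S; ring.
Qed.

Lemma Cmod2_plus (x y : C) :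
  Cmod (x + y) ^ 2 = Cmod x ^ 2 + Cmod y ^ 2 + 2 * Re (x * Cconj y).
Proof.
rewrite !Cmod2_alt; destruct x, y; unfold Re, Im; simpl; ring.
Qed.

(** Averages over finitely many points replace integrals over the circle; they are
    exact as soon as the degree is smaller than the number of points. *)
Lemma discrete_parseval (p : nat -> C) (N k : nat) :
  (N <= k)%nat ->
  sum_n (fun j => Cmod (Cpoly p N (unity_root k ^ j)) ^ 2) k
  = INR (S k) * sum_n (fun n => Cmod (p n) ^ 2) N.
Proof.
induction N as [|N IH]; intros HN.
- rewrite Rsum_0, <- Rsum_const.
  apply (sum_n_ext (G := R_AbelianMonoid)); intros j.
  unfold Cpoly; rewrite Csum_0; simpl (_ ^ 0)%C; now rewrite Cmult_1_r.
- rewrite Rsum_Sn, Rmult_plus_distr_l, <- IH, <- Rsum_const by lia.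
  set (w := fun j => (unity_root k ^ j)%C).
  assert (H : sum_n (fun j => 2 * Re (Cpoly p N (w j)
                        * Cconj (p (S N) * w j ^ S N))) k = 0).
  { rewrite Rsum_mult_l, <- Csum_Re.
    rewrite (Csum_ext _
      (fun j => (Cconj (p (S N)) * (Cpoly p N (w j) * Cconj (w j ^ S N)))%C)).
    - rewrite Csum_mult_l; unfold w; rewrite Cpoly_orthogonal by lia.
      rewrite Cmult_0_r; unfold Re; simpl; ring.
    - intros j; rewrite Cmult_conj; ring. }
  rewrite <- (Rplus_0_r (_ + _)), <- H, <- !Rsum_plus.
  apply (sum_n_ext (G := R_AbelianMonoid)); intros j.
  rewrite Cpoly_S; fold (w j); rewrite Cmod2_plus; unfold plus; simpl plus.
  rewrite Cmod_mult; unfold w; rewrite Cmod_pow, Cmod_unity_root_pow, pow1.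
  now rewrite Rmult_1_r.
Qed.

Lemma circle_parseval (p : nat -> C) (s : R) (N k : nat) :
  (N <= k)%nat ->
  sum_n (fun j => Cmod (Cpoly p N (s * unity_root k ^ j)) ^ 2) k
  = INR (S k) * sum_n (fun n => Cmod (p n) ^ 2 * s ^ (2 * n)) N.
Proof.
intros HN.
transitivity (INR (S k) * sum_n (fun n => Cmod (p n * s ^ n) ^ 2) N).
- rewrite <- discrete_parseval by exact HN.
  apply (sum_n_ext (G := R_AbelianMonoid)); intros j; do 2 f_equal.
  apply Csum_ext; intros n.
  rewrite Cpow_mult_l; ring.
- f_equal; apply (sum_n_ext (G := R_AbelianMonoid)); intros n.
  rewrite Cmod_mult, Rpow_mult_distr, Cmod_pow, Cmod_R; f_equal.
  now rewrite RPow_abs, pow2_abs, <- pow_mult, Nat.mul_comm.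
Qed.

Lemma Cpoly_uniform_approx (q : nat -> C) (G : C -> C) (s e : R) :
  disk_expansion q G -> 0 <= s < 1 -> 0 < e ->
  exists L0, forall L z, (L0 <= L)%nat -> Cmod z = s ->
    Cmod (Cpoly q L z) <= Cmod (G z) + e.
Proof.
intros HG Hs He.
set (t := (1 + s) / 2); set (x := s / t).
assert (Ht : s < t < 1) by (unfold t; lra).
assert (Hxt : x * t = s) by (unfold x; field; lra).
assert (Hx : 0 <= x < 1) by (split; nra).
destruct (disk_expansion_coef_bound q G t HG) as [B HB]; [lra|].
assert (HB0 : 0 <= B).
{ apply Rle_trans with (2 := HB 0%nat).
  apply Rmult_le_pos; [apply Cmod_ge_0|simpl; lra]. }
destruct (pow_lt_1_zero x ltac:(rewrite Rabs_pos_eq; lra)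
            (e * (1 - x) / (B + 1))) as [L0 HL0].
{ apply Rdiv_lt_0_compat; nra. }
exists L0; intros L z HL Hz.
assert (Hpow : 0 <= x ^ S L) by (apply pow_le; lra).
assert (Hsmall : B * x ^ S L / (1 - x) <= e).
{ specialize (HL0 (S L) ltac:(lia)); rewrite Rabs_pos_eq in HL0 by exact Hpow.
  apply Rmult_le_reg_r with (1 - x); [lra|].
  replace (B * x ^ S L / (1 - x) * (1 - x)) with (B * x ^ S L) by (field; lra).
  apply Rle_trans with ((B + 1) * (e * (1 - x) / (B + 1))); [|right; field; lra].
  apply Rmult_le_compat; lra. }
replace (Cpoly q L z) with (G z + - (G z - Cpoly q L z))%C by ring.
apply Rle_trans with (1 := Cmod_triangle _ _); rewrite Cmod_opp.
apply Rplus_le_compat_l, Rle_trans with (2 := Hsmall).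
apply Cseries_tail; [exact Hx| |apply HG; lra].
intros n; rewrite Cmod_mult, Cmod_pow, Hz, <- Hxt, Rpow_mult_distr.
rewrite (Rmult_comm (x ^ n)), <- Rmult_assoc.
apply Rmult_le_compat_r; [apply pow_le; lra|apply HB].
Qed.

(** On the left the weights [s ^ (2 * n)] are replaced by the smallest of them, so
    that letting [s] tend to 1 only involves one power. *)
Lemma circle_norm_partial_sum (q : nat -> C) (s : R) (N L : nat) :
  0 <= s <= 1 -> (N <= L)%nat ->
  s ^ (2 * N) * sum_n (fun n => Cmod (q n) ^ 2) N
  <= sum_n (fun n => Cmod (q n) ^ 2 * s ^ (2 * n)) L.
Proof.
intros Hs HL.
apply Rle_trans with (sum_n (fun n => Cmod (q n) ^ 2 * s ^ (2 * n)) N).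
- rewrite <- Rsum_mult_l; apply Rsum_le; intros n Hn.
  rewrite Rmult_comm; apply Rmult_le_compat_l; [apply pow2_ge_0|].
  replace (2 * N)%nat with (2 * n + 2 * (N - n))%nat by lia.
  apply Rle_trans with (s ^ (2 * n) * 1); [rewrite pow_add|right; apply Rmult_1_r].
  apply Rmult_le_compat_l; [apply pow_le; lra|].
  rewrite <- (pow1 (2 * (N - n))); apply pow_incr; lra.
- assert (Hmono : forall d, sum_n (fun n => Cmod (q n) ^ 2 * s ^ (2 * n)) N
               <= sum_n (fun n => Cmod (q n) ^ 2 * s ^ (2 * n)) (d + N)).
  { induction d as [|d IH]; [apply Rle_refl|].
    change (S d + N)%nat with (S (d + N)); rewrite Rsum_Sn.
    assert (0 <= Cmod (q (S (d + N))) ^ 2 * s ^ (2 * S (d + N))); [|lra].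
    apply Rmult_le_pos; [apply pow2_ge_0|apply pow_le; lra]. }
  replace L with ((L - N) + N)%nat by lia; apply Hmono.
Qed.

Lemma le_of_le_linear_error (x y K : R) :
  0 <= K -> (forall e, 0 < e <= 1 -> x <= y + e * K) -> x <= y.
Proof.
intros HK H; apply le_epsilon; intros d Hd.
set (e := Rmin 1 (d / (K + 1))).
assert (He : 0 < e <= 1).
{ split; [apply Rmin_pos; [lra|apply Rdiv_lt_0_compat; lra]|apply Rmin_l]. }
assert (He2 : e * (K + 1) <= d).
{ apply Rle_trans with (d / (K + 1) * (K + 1)); [|right; field; lra].
  apply Rmult_le_compat_r; [lra|apply Rmin_r]. }
specialize (H e He); lra.
Qed.

(** Both sides are compared with averages of squared moduli over the points
    [s * w], [w] a root of unity of order larger than both degrees.  As [G] is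
    only a power series, it is first replaced by a long partial sum, which costs
    an error [e] uniformly on the circle. *)
Lemma circle_norm_le (q p : nat -> C) (G : C -> C) (M N : nat) (s : R) :
  disk_expansion q G ->
  (forall z, Cmod z < 1 -> Cmod (G z) <= Cmod (Cpoly p M z)) ->
  0 <= s < 1 ->
  s ^ (2 * N) * sum_n (fun n => Cmod (q n) ^ 2) N
  <= sum_n (fun n => Cmod (p n) ^ 2) M.
Proof.
intros HG HGp Hs.
set (S2 := sum_n (fun n => Cmod (p n) ^ 2) M).
assert (HS2 : 0 <= S2) by (apply Rsum_ge_0; intros; apply pow2_ge_0).
apply le_of_le_linear_error with (S2 + 2); [lra|]; intros e He.
destruct (Cpoly_uniform_approx q G s e HG Hs ltac:(lra)) as [L0 Happrox].
set (L := max L0 N); set (k := max L M).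
assert (HK : 0 < INR (S k)) by (apply lt_0_INR; lia).
apply Rle_trans with (1 := circle_norm_partial_sum q s N L ltac:(lra) ltac:(lia)).
assert (H2 : sum_n (fun n => Cmod (p n) ^ 2 * s ^ (2 * n)) M <= S2).
{ apply Rsum_le; intros n _.
  rewrite <- (Rmult_1_r (Cmod (p n) ^ 2)) at 2.
  apply Rmult_le_compat_l; [apply pow2_ge_0|].
  rewrite <- (pow1 (2 * n)); apply pow_incr; lra. }
apply Rle_trans with
  ((1 + e) * sum_n (fun n => Cmod (p n) ^ 2 * s ^ (2 * n)) M + (e + e ^ 2)).
2: { apply (Rmult_le_compat_l (1 + e)) in H2; [nra|lra]. }
apply Rmult_le_reg_l with (1 := HK).
rewrite <- circle_parseval by lia.
apply Rle_trans with (sum_n (fun j =>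
  (1 + e) * Cmod (Cpoly p M (s * unity_root k ^ j)) ^ 2 + (e + e ^ 2)) k).
2: { right; rewrite Rsum_plus, Rsum_mult_l, Rsum_const, circle_parseval by lia.
     ring. }
apply Rsum_le; intros j _.
set (z := (s * unity_root k ^ j)%C).
assert (Hz : Cmod z = s).
{ unfold z; rewrite Cmod_mult, Cmod_unity_root_pow, Cmod_R, Rabs_pos_eq; lra. }
pose proof (Happrox L z ltac:(lia) Hz) as H3.
pose proof (HGp z ltac:(lra)) as H4.
pose proof (Cmod_ge_0 (Cpoly q L z)) as H5.
set (A := Cmod (Cpoly q L z)) in *; set (P := Cmod (Cpoly p M z)) in *.
apply Rle_trans with ((P + e) ^ 2); [apply pow_incr; lra|].
(* [2 * P * e <= e * P ^ 2 + e] splits the cross term. *)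
pose proof (pow2_ge_0 (P - 1)); nra.
Qed.

Lemma pow_ge_bernoulli (d : R) (n : nat) :
  0 <= d <= 1 -> 1 - INR n * d <= (1 - d) ^ n.
Proof.
intros Hd; induction n as [|n IH]; [simpl; lra|].
rewrite S_INR; simpl; pose proof (pos_INR n); nra.
Qed.

(** Pointwise domination in the disk passes to the norms of the Hardy space
    [H^2]: let the radius tend to 1 in [circle_norm_le]. *)
Lemma hardy_norm_le (q p : nat -> C) (G : C -> C) (M N : nat) :
  disk_expansion q G ->
  (forall z, Cmod z < 1 -> Cmod (G z) <= Cmod (Cpoly p M z)) ->
  sum_n (fun n => Cmod (q n) ^ 2) N <= sum_n (fun n => Cmod (p n) ^ 2) M.
Proof.
intros HG HGp.
set (S1 := sum_n (fun n => Cmod (q n) ^ 2) N).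
assert (HS1 : 0 <= S1) by (apply Rsum_ge_0; intros; apply pow2_ge_0).
pose proof (pos_INR (2 * N)) as HN.
apply le_of_le_linear_error with (INR (2 * N) * S1); [nra|]; intros e He.
pose proof (circle_norm_le q p G M N (1 - e) HG HGp ltac:(lra)) as H.
fold S1 in H.
pose proof (pow_ge_bernoulli e (2 * N) ltac:(lra)) as H1.
apply (Rmult_le_compat_r S1) in H1; [lra|exact HS1].
Qed.

(** * Coefficients of bounded functions *)

(** [hardy_norm_le] for [g * (1 + c z^(m+1))], whose coefficient of index [m + 1]
    mixes [b (S m)] and [b 0]. *)
Lemma two_term_multiplier (b : nat -> C) (g : C -> C) (m : nat) (c : C) :
  disk_expansion b g -> (forall z, Cmod z < 1 -> Cmod (g z) <= 1) ->
  sum_n (fun n => Cmod (b n) ^ 2) m + Cmod (b (S m) + c * b 0%nat) ^ 2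
  <= 1 + Cmod c ^ 2.
Proof.
intros Hb Hg.
set (q := fun n => (b n + c * PS_incr_n (V := AbsRing_NormedModule C_AbsRing) b (S m) n)%C).
set (p := fun n => if Nat.eqb n 0 then RtoC 1 else if Nat.eqb n (S m) then c else RtoC 0).
assert (Hp : forall k, (0 < k <= m)%nat -> p k = RtoC 0).
{ intros k Hk; unfold p.
  rewrite (proj2 (Nat.eqb_neq k 0)) by lia.
  now rewrite (proj2 (Nat.eqb_neq k (S m))) by lia. }
assert (HpS : p (S m) = c) by (unfold p; simpl; now rewrite Nat.eqb_refl).
assert (Hq : disk_expansion q (fun z => (1 + c * z ^ S m) * g z)%C).
{ intros z Hz.
  pose proof (proj2 (is_pseries_C _ _ _) (Hb z Hz)) as H.
  pose proof (is_pseries_incr_n _ (S m) _ _ H) as H1.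
  apply (is_pseries_scal c) in H1; [|exact (Cmult_comm _ _)].
  pose proof (is_pseries_plus _ _ _ _ _ H H1) as H2.
  apply (proj1 (is_pseries_C q z _)).
  match type of H2 with is_pseries _ _ ?y =>
    replace ((1 + c * z ^ S m) * g z)%C with y end.
  - exact H2.
  - change (g z + c * (z ^ S m * g z) = (1 + c * z ^ S m) * g z)%C; ring. }
assert (Hle : sum_n (fun n => Cmod (q n) ^ 2) (S m)
              <= sum_n (fun n => Cmod (p n) ^ 2) (S m)).
{ apply (hardy_norm_le q p _ (S m) (S m) Hq); intros z Hz.
  unfold Cpoly; rewrite Csum_Sn, Csum_head, HpS.
  2: { intros k Hk; rewrite Hp by exact Hk; ring. }
  replace (p 0%nat * z ^ 0)%C with (RtoC 1) by (unfold p; simpl; ring).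
  apply Rle_trans with (Cmod (1 + c * z ^ S m) * 1); [|right; apply Rmult_1_r].
  rewrite Cmod_mult; apply Rmult_le_compat_l; auto using Cmod_ge_0. }
rewrite !Rsum_Sn, HpS in Hle.
rewrite (Rsum_head (fun n => Cmod (p n) ^ 2)) in Hle.
2: { intros k Hk; rewrite Hp, Cmod_0 by exact Hk; ring. }
replace (p 0%nat) with (RtoC 1) in Hle by reflexivity.
rewrite Cmod_1, pow1 in Hle.
rewrite (Rsum_ext (fun n => Cmod (q n) ^ 2) (fun n => Cmod (b n) ^ 2)) in Hle.
- replace (q (S m)) with (b (S m) + c * b 0%nat)%C in Hle; [exact Hle|].
  unfold q; rewrite PS_incr_n_simplify.
  destruct (Compare_dec.le_lt_dec (S m) (S m)); [|lia].
  now rewrite Nat.sub_diag.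
- intros k Hk; unfold q; rewrite PS_incr_n_simplify.
  destruct (Compare_dec.le_lt_dec (S m) k); [lia|].
  change (Cmod (b k + c * 0) ^ 2 = Cmod (b k) ^ 2).
  do 2 f_equal; ring.
Qed.

(** The classical sharp form: for [m = 0] this is the Schwarz-Pick bound
    [|b 1| <= 1 - |b 0|^2].  It is also what the Schwarz lemma for
    [(g - b 0) / (1 - conj (b 0) g)] gives after taking norms. *)
Lemma schur_coefficient_bound (b : nat -> C) (g : C -> C) (m : nat) :
  disk_expansion b g -> (forall z, Cmod z < 1 -> Cmod (g z) <= 1) ->
  Cmod (b (S m)) ^ 2
  <= (1 - Cmod (b 0%nat) ^ 2) * (1 - sum_n (fun n => Cmod (b n) ^ 2) m).
Proof.
intros Hb Hg.
pose proof (fun c => two_term_multiplier b g m c Hb Hg) as H.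
set (X := sum_n (fun n => Cmod (b n) ^ 2) m) in *.
set (a := Cmod (b 0%nat)) in *.
assert (HX : a ^ 2 <= X).
{ unfold X; destruct m as [|m]; [rewrite Rsum_0; apply Rle_refl|].
  rewrite Rsum_shift; fold a.
  assert (0 <= sum_n (fun k => Cmod (b (S k)) ^ 2) m); [|lra].
  apply Rsum_ge_0; intros; apply pow2_ge_0. }
assert (Hy := pow2_ge_0 (Cmod (b (S m)))).
pose proof (H (RtoC 0)) as H0.
replace (b (S m) + 0 * b 0%nat)%C with (b (S m)) in H0 by ring.
rewrite Cmod_0 in H0.
destruct (Req_dec (a ^ 2) 1) as [Ha|Ha]; [rewrite Ha in *; nra|].
assert (Ha1 : 0 < 1 - a ^ 2) by nra.
(* This [c] maximises [Cmod (b (S m) + c * b 0) ^ 2 - Cmod c ^ 2], whose maximum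
   is [Cmod (b (S m)) ^ 2 / (1 - a ^ 2)]. *)
specialize (H (b (S m) * Cconj (b 0%nat) / RtoC (1 - a ^ 2))%C).
assert (Hne : RtoC (1 - a ^ 2) <> 0) by (intros E; apply RtoC_inj in E; lra).
replace (b (S m) + b (S m) * Cconj (b 0%nat) / RtoC (1 - a ^ 2) * b 0%nat)%C
  with (b (S m) / RtoC (1 - a ^ 2))%C in H.
2: { transitivity (b (S m) * (RtoC (1 - a ^ 2) + b 0%nat * Cconj (b 0%nat))
                   / RtoC (1 - a ^ 2))%C; [|field; exact Hne].
     rewrite <- Cmod2_conj; fold a; rewrite <- RtoC_plus.
     replace (1 - a ^ 2 + a ^ 2) with 1 by ring; now rewrite Cmult_1_r. }
rewrite !Cmod_div, Cmod_mult, Cmod_conj in H by exact Hne.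
rewrite Cmod_R, Rabs_pos_eq in H by lra; fold a in H.
set (y := Cmod (b (S m))) in *.
assert (E1 : (y / (1 - a ^ 2)) ^ 2 - (y * a / (1 - a ^ 2)) ^ 2 = y ^ 2 / (1 - a ^ 2))
  by (field; lra).
assert (E2 : y ^ 2 / (1 - a ^ 2) <= 1 - X) by lra.
apply (Rmult_le_compat_l (1 - a ^ 2)) in E2; [|lra].
replace ((1 - a ^ 2) * (y ^ 2 / (1 - a ^ 2))) with (y ^ 2) in E2 by (field; lra).
exact E2.
Qed.

(** The hypotheses say that the sequence [y n - a^2 y (n-1)] has partial sums at
    most [(1 - a^2)^2].  Weighting it by the nonincreasing [rho ^ n] preserves this
    bound (Abel), and its weighted sum is at least [1 - a^2 rho] times that of [y]. *)
Lemma weighted_square_sum_bound (y : nat -> R) (a rho : R) (N : nat) :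
  0 <= a < 1 -> 0 <= rho <= 1 -> (forall n, 0 <= y n) ->
  y 0%nat <= (1 - a ^ 2) ^ 2 ->
  (forall m, y (S m) <= (1 - a ^ 2) * (1 - a ^ 2 - sum_n y m)) ->
  (1 - a ^ 2 * rho) * sum_n (fun n => y n * rho ^ n) N <= (1 - a ^ 2) ^ 2.
Proof.
intros Ha Hr Hy H0 HS.
set (D := (1 - a ^ 2) ^ 2) in *.
assert (HE : forall n, (1 - a ^ 2) * sum_n y n + a ^ 2 * y n <= D).
{ intros [|n]; [rewrite Rsum_0; lra|].
  rewrite Rsum_Sn; specialize (HS n); unfold D; nra. }
(* Abel summation as an invariant: the left-hand side is the weighted partial sum
   of [y n - a ^ 2 * y (n - 1)], and [(1 - a ^ 2) * sum_n y N + a ^ 2 * y N] is its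
   unweighted one. *)
assert (HI : (1 - a ^ 2 * rho) * sum_n (fun n => y n * rho ^ n) N
               + a ^ 2 * rho ^ S N * y N
             <= D - rho ^ N * (D - ((1 - a ^ 2) * sum_n y N + a ^ 2 * y N))).
{ induction N as [|N IH]; [rewrite !Rsum_0; simpl; lra|].
  rewrite !Rsum_Sn.
  specialize (HE N).
  assert (Hp : 0 <= (rho ^ N - rho ^ S N)
                     * (D - ((1 - a ^ 2) * sum_n y N + a ^ 2 * y N))).
  { apply Rmult_le_pos; [|lra].
    pose proof (pow_le rho N (proj1 Hr)); simpl; nra. }
  simpl pow in *.
  set (s := sum_n (fun n => y n * rho ^ n) N) in *.
  set (Y := sum_n y N) in *.
  lra. }
specialize (HE N); specialize (Hy N).
pose proof (pow_le rho N (proj1 Hr)); pose proof (pow_le rho (S N) (proj1 Hr)).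
assert (0 <= a ^ 2 * rho ^ S N * y N)
  by (apply Rmult_le_pos; [apply Rmult_le_pos; [apply pow2_ge_0|]|]; assumption).
nra.
Qed.

Lemma amgm_of_square (x u v l : R) :
  0 < l -> 0 <= u -> 0 <= v -> x ^ 2 = u * v -> 2 * x <= u / l + l * v.
Proof.
intros Hl Hu Hv Hx.
set (w := u / l); assert (Huw : u = l * w) by (unfold w; field; lra).
assert (Hw : 0 <= w) by (unfold w; apply Rdiv_le_0_compat; lra).
assert (0 <= l * v) by nra.
apply Rnot_lt_le; intros Hlt.
assert (w * (l * v) = x ^ 2) by (rewrite Hx, Huw; ring).
pose proof (pow2_ge_0 (w - l * v)); nra.
Qed.

(** Since [t ^ (2 n) = rho ^ n * (a t) ^ n] for [rho = t / a], each
    [b (n+1) t ^ n] is the geometric mean of a term of the weighted sum of squares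
    and a term of a geometric series.  This [rho], together with the weight
    [1 - a ^ 2] in the mean inequality, makes the two contributions equal and the
    bound sharp. *)
Lemma bombieri_bound (b : nat -> R) (a t : R) (N : nat) :
  0 < a <= 1 -> 0 <= t <= a ->
  (forall n, 0 <= b n) -> b 0%nat = a ->
  (forall m, b (S m) ^ 2 <= (1 - a ^ 2) * (1 - sum_n (fun n => b n ^ 2) m)) ->
  sum_n (fun n => b n * t ^ n) N <= a + (1 - a ^ 2) * t / (1 - a * t).
Proof.
intros Ha Ht Hb H0 HS.
destruct (Req_dec a 1) as [Ha1|Ha1].
{ rewrite Ha1 in *; unfold Rdiv; right.
  rewrite (Rsum_head (fun k => b k * t ^ k)).
  - rewrite H0; simpl; ring.
  - intros [|k] Hk; [lia|].
    assert (Hbk : b (S k) = 0) by (pose proof (HS k); nra).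
    rewrite Hbk; ring. }
assert (Hat : a * t < 1) by nra.
assert (Hpos : 0 <= (1 - a ^ 2) * t / (1 - a * t)).
{ apply Rdiv_le_0_compat; [apply Rmult_le_pos; nra|lra]. }
destruct N as [|N]; [rewrite Rsum_0, H0; simpl; lra|].
rewrite Rsum_shift, H0; simpl (t ^ 0); rewrite Rmult_1_r.
apply Rplus_le_compat_l.
set (rho := t / a).
assert (Hrho : rho * a = t) by (unfold rho; field; lra).
assert (Hr : 0 <= rho <= 1) by (split; nra).
assert (HT := weighted_square_sum_bound (fun n => b (S n) ^ 2) a rho N
  ltac:(lra) Hr (fun n => pow2_ge_0 _)).
set (T := sum_n (fun n => b (S n) ^ 2 * rho ^ n) N) in *.
assert (HT' : (1 - a * t) * T <= (1 - a ^ 2) ^ 2).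
{ replace (a * t) with (a ^ 2 * rho) by (rewrite <- Hrho; ring).
  apply HT.
  - specialize (HS 0%nat); rewrite Rsum_0, H0 in HS; lra.
  - intros m; specialize (HS (S m)); rewrite Rsum_shift, H0 in HS; lra. }
assert (Hgeo : (1 - a * t) * sum_n (fun n => (a * t) ^ n) N <= 1).
{ rewrite Rgeom_sum; pose proof (pow_le (a * t) (S N) ltac:(nra)); lra. }
set (Q := sum_n (fun n => (a * t) ^ n) N) in *.
assert (Hsum : 2 * sum_n (fun k => b (S k) * t ^ k) N
               <= T / (1 - a ^ 2) + (1 - a ^ 2) * Q).
{ unfold T, Q; rewrite <- !Rsum_mult_l; unfold Rdiv.
  rewrite (Rmult_comm (sum_n _ N)), <- Rsum_mult_l, <- Rsum_plus.
  apply Rsum_le; intros k _; rewrite (Rmult_comm (/ _)).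
  apply amgm_of_square; [nra| | |].
  - apply Rmult_le_pos; [apply pow2_ge_0|apply pow_le; lra].
  - apply pow_le; nra.
  - rewrite Rmult_assoc, <- Rpow_mult_distr, Rpow_mult_distr; f_equal.
    replace (rho * (a * t)) with (t * t) by (rewrite <- Hrho at 1; ring).
    rewrite Rpow_mult_distr; ring. }
rewrite (Rsum_ext _ (fun k => t * (b (S k) * t ^ k)))
  by (intros; simpl; ring).
rewrite Rsum_mult_l.
set (Z := sum_n (fun k => b (S k) * t ^ k) N) in *.
assert (HZ : (1 - a * t) * Z <= 1 - a ^ 2).
{ assert (Ha2 : 0 < 1 - a ^ 2) by nra.
  assert (HT2 : (1 - a * t) * (T / (1 - a ^ 2)) <= 1 - a ^ 2).
  { apply Rmult_le_reg_r with (1 - a ^ 2); [lra|].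
    replace ((1 - a * t) * (T / (1 - a ^ 2)) * (1 - a ^ 2))
      with ((1 - a * t) * T) by (field; lra).
    simpl in *; lra. }
  apply (Rmult_le_compat_l (1 - a ^ 2)) in Hgeo; [|lra].
  apply (Rmult_le_compat_l (1 - a * t)) in Hsum; [|lra].
  lra. }
apply Rmult_le_reg_l with (1 - a * t); [lra|].
replace ((1 - a * t) * ((1 - a ^ 2) * t / (1 - a * t)))
  with (t * (1 - a ^ 2)) by (field; lra).
replace ((1 - a * t) * (t * Z)) with (t * ((1 - a * t) * Z)) by ring.
apply Rmult_le_compat_l; lra.
Qed.

(** * Upper bound for the majorant series *)

Lemma increment_le_of_derive_le (F G f g : R -> R) (r : R) :
  0 <= r ->
  (forall t, 0 <= t <= r -> is_derive F t (f t)) ->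
  (forall t, 0 <= t <= r -> is_derive G t (g t)) ->
  (forall t, 0 <= t <= r -> f t <= g t) ->
  F r - F 0 <= G r - G 0.
Proof.
intros Hr HF HG Hfg.
assert (HD : forall t, 0 <= t <= r ->
          is_derive (fun x => minus (G x) (F x)) t (g t - f t)).
{ intros t Ht.
  exact (is_derive_minus G F t (g t) (f t) (HG t Ht) (HF t Ht)). }
destruct (MVT_gen (fun x => minus (G x) (F x)) 0 r (fun t => g t - f t))
  as [t [Ht E]].
- intros t; rewrite Rmin_left, Rmax_right by lra; intros Ht; apply HD; lra.
- intros t; rewrite Rmin_left, Rmax_right by lra; intros Ht.
  apply continuity_pt_filterlim.
  apply (ex_derive_continuous (fun x => minus (G x) (F x)) t).
  exists (g t - f t); exact (HD t Ht).
- rewrite Rmin_left, Rmax_right in Ht by lra.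
  change (G r - F r - (G 0 - F 0) = (g t - f t) * (r - 0)) in E.
  specialize (Hfg t Ht); nra.
Qed.

Definition primitive_sum (b : nat -> R) (N : nat) (r : R) : R :=
  sum_n (fun n => b n / INR (S n) * r ^ S n) N.

Lemma is_derive_primitive_sum (b : nat -> R) (N : nat) (t : R) :
  is_derive (primitive_sum b N) t (sum_n (fun n => b n * t ^ n) N).
Proof.
unfold primitive_sum; apply (is_derive_sum_n (V := R_NormedModule)).
intros n _; auto_derive; [exact I|].
change (match n with O => 1 | S _ => INR n + 1 end) with (INR (S n)).
assert (INR (S n) <> 0) by (apply not_0_INR; lia).
simpl pred; field; assumption.
Qed.

Lemma primitive_sum_0 (b : nat -> R) (N : nat) : primitive_sum b N 0 = 0.
Proof.
unfold primitive_sum; induction N as [|N IH].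
- rewrite Rsum_0; simpl; ring.
- rewrite Rsum_Sn, IH; simpl; ring.
Qed.

Lemma majorant_partial_sum (c : nat -> C) (r : R) (N : nat) :
  c 0%nat = RtoC 0 ->
  sum_n (fun n => Cmod (c n) * r ^ n) (S N)
  = primitive_sum (fun n => Cmod (INR (S n) * c (S n))) N r.
Proof.
intros H0; rewrite Rsum_shift, H0, Cmod_0, Rmult_0_l, Rplus_0_l.
unfold primitive_sum; apply Rsum_ext; intros n _.
assert (0 < INR (S n)) by (apply lt_0_INR; lia).
rewrite Cmod_mult, Cmod_R, Rabs_pos_eq by lra.
field; lra.
Qed.

(** The majorant series of the extremal function, in closed form: the primitive of
    [bombieri_majorant a] that vanishes at [0]. *)
Definition extremal_primitive (a r : R) : R :=
  (2 * a ^ 2 - 1) / a * r - (1 - a ^ 2) / a ^ 2 * ln (1 - a * r).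

Definition bombieri_majorant (a t : R) : R := a + (1 - a ^ 2) * t / (1 - a * t).

Lemma is_derive_extremal_primitive (a t : R) :
  0 < a -> a * t < 1 ->
  is_derive (extremal_primitive a) t (bombieri_majorant a t).
Proof.
intros Ha Ht; unfold extremal_primitive, bombieri_majorant.
auto_derive; [lra|]. field; lra.
Qed.

Lemma extremal_primitive_0 (a : R) : extremal_primitive a 0 = 0.
Proof.
unfold extremal_primitive; rewrite !Rmult_0_r, Rminus_0_r, ln_1; ring.
Qed.

Lemma extremal_primitive_increasing (a r r' : R) :
  0 < a <= 1 -> 0 <= r < r' -> a * r' < 1 ->
  extremal_primitive a r < extremal_primitive a r'.
Proof.
intros Ha Hr Har.
apply (incr_function_le (extremal_primitive a) 0 r' (bombieri_majorant a));
  simpl; try lra.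
- intros x H1 H2; apply is_derive_extremal_primitive; nra.
- intros x H1 H2; unfold bombieri_majorant.
  assert (0 <= (1 - a ^ 2) * x / (1 - a * x)); [|lra].
  apply Rdiv_le_0_compat; [apply Rmult_le_pos|]; nra.
Qed.

Lemma disk_sup_norm_le_iff (g : C -> C) (B : R) :
  Rbar_le (disk_sup_norm g) B <-> (forall z, Cmod z < 1 -> Cmod (g z) <= B).
Proof.
unfold disk_sup_norm; set (E := fun x => exists z, Cmod z < 1 /\ x = Cmod (g z)).
destruct (Lub_Rbar_correct E) as [Hub Hleast]; split.
- intros H z Hz.
  apply (Rbar_le_trans (Cmod (g z)) (Lub_Rbar E) B); [|exact H].
  apply Hub; now exists z.
- intros H; apply Hleast; intros x [z [Hz ->]]; exact (H z Hz).
Qed.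

(** The primitive [F] is left abstract because at [a = rho = 1] the closed form
    [extremal_primitive] is not differentiable at [rho], whereas the identity is a
    primitive: there [bombieri_majorant 1] is constant, also at [1], where division
    by [0] is multiplied by [0]. *)
Lemma bohr_admissible_of_primitive (a rho : R) (F : R -> R) :
  0 < a <= 1 -> 0 <= rho <= a ->
  (forall t, 0 <= t <= rho -> is_derive F t (bombieri_majorant a t)) ->
  F 0 = 0 -> (forall r, 0 <= r <= rho -> F r <= 1) ->
  bohr_admissible a rho.
Proof.
intros Ha Hrho HF HF0 HF1; split; [lra|].
intros f c [Hc0 Hf] Hsup Hc1 r Hr.
assert (Hexp : disk_expansion c f).
{ intros z Hz; apply (proj1 (is_pseries_C c z (f z))), Hf, Hz. }
set (b := fun n => (INR (S n) * c (S n))%C).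
assert (Hb : disk_expansion b (C_derive f)).
{ intros z Hz; exact (disk_expansion_derive c f z Hexp Hz). }
assert (Hb0 : Cmod (b 0%nat) = a).
{ unfold b; simpl; now rewrite Cmult_1_l. }
pose proof (proj1 (disk_sup_norm_le_iff (C_derive f) 1) Hsup) as Hg.
assert (HS : forall m, Cmod (b (S m)) ^ 2
               <= (1 - a ^ 2) * (1 - sum_n (fun n => Cmod (b n) ^ 2) m)).
{ intros m; rewrite <- Hb0; exact (schur_coefficient_bound b _ m Hb Hg). }
apply Rbar_le_trans with (Lim_seq (fun _ => 1));
  [|rewrite Lim_seq_const; apply Rbar_le_refl].
apply Lim_seq_le_loc; exists 1%nat; intros [|N] HN; [lia|].
rewrite majorant_partial_sum by exact Hc0; fold b.
apply Rle_trans with (F r); [|exact (HF1 r Hr)].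
enough (primitive_sum (fun n => Cmod (b n)) N r
        - primitive_sum (fun n => Cmod (b n)) N 0 <= F r - F 0)
  by (rewrite primitive_sum_0 in *; unfold b in *; lra).
apply (increment_le_of_derive_le _ _
         (fun t => sum_n (fun n => Cmod (b n) * t ^ n) N) (bombieri_majorant a)).
- lra.
- intros t _; apply (is_derive_primitive_sum (fun n => Cmod (b n)) N t).
- intros t Ht; apply HF; lra.
- intros t Ht; apply bombieri_bound; auto using Cmod_ge_0; lra.
Qed.

(** * The extremal function *)

Lemma is_Cseries_geom (q : C) :
  Cmod q < 1 -> is_Cseries (fun n => (q ^ n)%C) (/ (1 - q))%C.
Proof.
intros Hq; apply is_Cseries_lim.
assert (Hne := one_minus_neq_0 q Hq).
apply is_lim_seq_ext with (fun n => Cmod q * / Cmod (1 - q) * Cmod q ^ n).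
- intros n.
  replace (Csum (fun k => (q ^ k)%C) n - / (1 - q))%C
    with (- (q * / (1 - q) * q ^ n))%C.
  + now rewrite Cmod_opp, !Cmod_mult, Cmod_inv, Cmod_pow by exact Hne.
  + transitivity ((1 - q) * Csum (fun k => (q ^ k)%C) n * / (1 - q)
                  - / (1 - q))%C; [|field; exact Hne].
    rewrite Cgeom_sum, Cpow_S; field; exact Hne.
- rewrite <- (Rmult_0_r (Cmod q * / Cmod (1 - q))).
  apply (is_lim_seq_scal_l _ _ (Finite 0)), is_lim_seq_geom.
  rewrite Rabs_pos_eq; [exact Hq|apply Cmod_ge_0].
Qed.

(** Coefficients of the primitive of the Moebius map
    [(a - z) / (1 - a z) = a - (1 - a^2) * (z + a z^2 + a^2 z^3 + ...)]. *)
Definition extremal_coef (a : R) (n : nat) : R :=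
  match n with
  | O => 0
  | S O => a
  | S (S m) => - ((1 - a ^ 2) * a ^ m / INR (S (S m)))
  end.

Lemma extremal_coef_derive (a : R) (n : nat) :
  INR (S (S n)) * extremal_coef a (S (S n)) = - ((1 - a ^ 2) * a ^ n).
Proof.
assert (0 < INR (S (S n))) by (apply lt_0_INR; lia).
cbn [extremal_coef]; field; lra.
Qed.

Lemma moebius_le_1 (a : R) (z : C) :
  0 < a <= 1 -> Cmod z < 1 -> Cmod ((a - z) / (1 - a * z)) <= 1.
Proof.
intros Ha Hz; pose proof (Cmod_ge_0 z) as Hz0.
assert (Hne : (1 - a * z)%C <> RtoC 0).
{ apply one_minus_neq_0; rewrite Cmod_mult, Cmod_R, Rabs_pos_eq by lra; nra. }
assert (Hpos := proj1 (Cmod_gt_0 _) Hne).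
rewrite Cmod_div by exact Hne.
apply Rmult_le_reg_r with (1 := Hpos).
unfold Rdiv; rewrite Rmult_assoc, Rinv_l, Rmult_1_l, Rmult_1_r by lra.
apply Rsqr_incr_0; [|apply Cmod_ge_0|lra].
rewrite !Rsqr_pow2, !Cmod2_alt.
assert (H : Cmod z ^ 2 <= 1) by nra.
rewrite Cmod2_alt in H; destruct z as [x y]; unfold Re, Im in *; simpl in *.
assert (0 <= (1 - a * a) * (1 - (x * (x * 1) + y * (y * 1)))) by
  (apply Rmult_le_pos; nra).
nra.
Qed.

Lemma extremal_function (a : R) :
  0 < a <= 1 ->
  exists f : C -> C,
    H1_expansion f (fun n => RtoC (extremal_coef a n)) /\
    Rbar_le (disk_sup_norm (C_derive f)) 1.
Proof.
intros Ha.
assert (Hcoef : forall n, Rabs (extremal_coef a n) <= 1).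
{ intros [|[|n]]; cbn [extremal_coef].
  - rewrite Rabs_R0; lra.
  - rewrite Rabs_pos_eq; lra.
  - assert (Hn : 1 <= INR (S (S n))).
    { rewrite S_INR, S_INR; pose proof (pos_INR n); lra. }
    assert (Hpow : 0 <= a ^ n <= 1).
    { split; [apply pow_le; lra|rewrite <- (pow1 n); apply pow_incr; lra]. }
    assert (Ha2 : 0 <= 1 - a ^ 2 <= 1) by nra.
    rewrite Rabs_Ropp, Rabs_pos_eq.
    + apply Rmult_le_reg_r with (INR (S (S n))); [lra|].
      unfold Rdiv; rewrite Rmult_assoc, Rinv_l by lra; nra.
    + apply Rdiv_le_0_compat; [apply Rmult_le_pos; lra|lra]. }
set (c := fun n => RtoC (extremal_coef a n)).
assert (Hex : forall z, Cmod z < 1 ->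
          exists l, is_Cseries (fun n => (c n * z ^ n)%C) l).
{ intros z Hz; apply (ex_Cseries_geom _ 1 (Cmod z)).
  - split; [apply Cmod_ge_0|exact Hz].
  - intros n; rewrite Cmod_mult, Cmod_pow; apply Rmult_le_compat_r.
    + apply pow_le, Cmod_ge_0.
    + unfold c; rewrite Cmod_R; apply Hcoef. }
set (f := fun z => epsilon (inhabits (RtoC 0))
                     (fun l => is_Cseries (fun n => (c n * z ^ n)%C) l)).
assert (Hf : disk_expansion c f).
{ intros z Hz; unfold f; apply epsilon_spec, Hex, Hz. }
exists f; split.
- split; [reflexivity|].
  intros z Hz; apply (proj2 (is_pseries_C c z (f z))), Hf, Hz.
- apply disk_sup_norm_le_iff; intros z Hz.
  pose proof (disk_expansion_derive c f z Hf Hz) as Hd.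
  assert (Haz : Cmod (a * z) < 1).
  { rewrite Cmod_mult, Cmod_R, Rabs_pos_eq by lra.
    pose proof (Cmod_ge_0 z); nra. }
  assert (Hne := one_minus_neq_0 _ Haz).
  replace (C_derive f z) with ((a - z) / (1 - a * z))%C;
    [exact (moebius_le_1 a z Ha Hz)|].
  apply (Cseries_unique _ _ _) with (2 := Hd).
  pose proof (is_series_scal (- ((1 - a * a) * z))%C _ _ (is_Cseries_geom _ Haz)) as H.
  apply (is_series_decr_1 (V := AbsRing_NormedModule C_AbsRing)).
  match type of H with is_series _ ?y =>
    match goal with |- is_series _ ?x => replace x with y end end.
  + revert H; apply is_series_ext; intros n.
    change ((- ((1 - a * a) * z) * (a * z) ^ n)
            = INR (S (S n)) * c (S (S n)) * z ^ S n)%C.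
    unfold c; rewrite <- (RtoC_mult (INR (S (S n)))), extremal_coef_derive.
    rewrite RtoC_opp, RtoC_mult, RtoC_minus, !RtoC_pow.
    rewrite Cpow_mult_l, !Cpow_S; simpl (_ ^ 0)%C; ring.
  + change (- ((1 - a * a) * z) * / (1 - a * z)
            = (a - z) / (1 - a * z) + - (INR 1 * a * z ^ 0))%C.
    simpl; field; exact Hne.
Qed.

(** Just beyond [rho], the partial sums of the majorant series of the extremal
    function approach [extremal_primitive a r > 1]: their derivatives miss
    [bombieri_majorant a] only by the tail of a geometric series of ratio at most
    [a r]. *)
Lemma le_of_bohr_admissible (a rho : R) :
  0 < a < 1 -> 0 <= rho -> a * rho < 1 -> 1 <= extremal_primitive a rho ->
  forall rho', bohr_admissible a rho' -> rho' <= rho.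
Proof.
intros Ha Hrho Har HPhi rho' [_ Hadm]; apply Rnot_lt_le; intros Hlt.
(* A point beyond [rho], within the reach of [rho'], and before the pole [1 / a]. *)
set (r := Rmin rho' ((rho + 1 / a) / 2)).
assert (Hinv : rho < 1 / a) by (apply Rmult_lt_reg_l with a; [lra|]; field_simplify; lra).
assert (Hr : rho < r) by (apply Rmin_glb_lt; lra).
assert (Hr' : r <= rho') by apply Rmin_l.
assert (Har' : a * r < 1).
{ apply Rle_lt_trans with (a * ((rho + 1 / a) / 2)).
  - apply Rmult_le_compat_l; [lra|apply Rmin_r].
  - replace (a * ((rho + 1 / a) / 2)) with ((a * rho + 1) / 2) by (field; lra); lra. }
pose proof (extremal_primitive_increasing a rho r ltac:(lra) ltac:(lra) Har') as Hgt.
destruct (extremal_function a ltac:(lra)) as [f [Hf Hsup]].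
set (c := fun n => RtoC (extremal_coef a n)) in *.
assert (Hmaj := Hadm f c Hf Hsup).
assert (Hc1 : Cmod (c 1%nat) = a) by (unfold c; simpl; rewrite Cmod_R, Rabs_pos_eq; lra).
specialize (Hmaj Hc1 r ltac:(lra)).
set (b := fun n => Cmod (INR (S n) * c (S n))).
assert (Hb0 : b 0%nat = a).
{ unfold b; simpl; now rewrite Cmult_1_l. }
assert (HbS : forall n, b (S n) = (1 - a ^ 2) * a ^ n).
{ intros n; unfold b, c; rewrite <- RtoC_mult, Cmod_R, extremal_coef_derive.
  rewrite Rabs_Ropp, Rabs_pos_eq; [reflexivity|].
  apply Rmult_le_pos; [nra|apply pow_le; lra]. }
set (x := a * r) in *.
assert (Hx : 0 <= x) by (apply Rmult_le_pos; lra).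
set (K := (1 - a ^ 2) * r / (1 - x)).
assert (HK : 0 <= K).
{ apply Rdiv_le_0_compat; [apply Rmult_le_pos; nra|lra]. }
assert (Hlow : forall N, extremal_primitive a r - K * x ^ S N * r
                         <= primitive_sum b (S N) r).
{ intros N.
  enough (H : extremal_primitive a r - K * x ^ S N * r
              - (extremal_primitive a 0 - K * x ^ S N * 0)
              <= primitive_sum b (S N) r - primitive_sum b (S N) 0).
  { rewrite primitive_sum_0, extremal_primitive_0 in H; lra. }
  apply (increment_le_of_derive_le
           (fun t => extremal_primitive a t - K * x ^ S N * t) _
           (fun t => bombieri_majorant a t - K * x ^ S N)
           (fun t => sum_n (fun n => b n * t ^ n) (S N))).
  - lra.
  - intros t Ht.
    apply (is_derive_minus (extremal_primitive a) (fun t => K * x ^ S N * t)).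
    + apply is_derive_extremal_primitive; unfold x in *; nra.
    + set (k := K * x ^ S N); auto_derive; [exact I|apply Rmult_1_r].
  - intros t _; apply is_derive_primitive_sum.
  - intros t Ht.
    assert (Htx : 0 <= a * t <= x) by (unfold x; split; nra).
    rewrite Rsum_shift, Hb0; unfold bombieri_majorant.
    rewrite (Rsum_ext _ (fun k => (1 - a ^ 2) * t * (a * t) ^ k)).
    2: { intros k _; rewrite HbS, Rpow_mult_distr; simpl; ring. }
    rewrite Rsum_mult_l.
    pose proof (Rgeom_sum (a * t) N) as Hg.
    assert (Hq : sum_n (fun k => (a * t) ^ k) N
                 = (1 - (a * t) ^ S N) / (1 - a * t)).
    { apply Rmult_eq_reg_l with (1 - a * t); [rewrite Hg; field; lra|lra]. }
    change (sum_n (pow (a * t)) N) with (sum_n (fun k => (a * t) ^ k) N).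
    rewrite Hq.
    assert (Hk : (1 - a ^ 2) * t / (1 - a * t) * (a * t) ^ S N <= K * x ^ S N).
    { apply Rmult_le_compat.
      - apply Rdiv_le_0_compat; [apply Rmult_le_pos; nra|lra].
      - apply pow_le; lra.
      - unfold K, Rdiv; apply Rmult_le_compat.
        + apply Rmult_le_pos; nra.
        + left; apply Rinv_0_lt_compat; lra.
        + apply Rmult_le_compat_l; [nra|lra].
        + apply Rinv_le_contravar; lra.
      - apply pow_incr; lra. }
    simpl (t ^ 0).
    replace ((1 - a ^ 2) * t * ((1 - (a * t) ^ S N) / (1 - a * t)))
      with ((1 - a ^ 2) * t / (1 - a * t)
            - (1 - a ^ 2) * t / (1 - a * t) * (a * t) ^ S N)
      by (field; lra).
    lra. }
set (d := extremal_primitive a r - 1).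
assert (Hd : 0 < d) by (unfold d; lra).
destruct (pow_lt_1_zero x ltac:(rewrite Rabs_pos_eq; lra)
            (d / (2 * (K * r + 1)))) as [N0 HN0].
{ apply Rdiv_lt_0_compat; [lra|nra]. }
assert (Hge : Rbar_le (1 + d / 2) (Defs.majorant c r)).
{ apply Rbar_le_trans with (Lim_seq (fun _ => 1 + d / 2));
    [rewrite Lim_seq_const; apply Rbar_le_refl|].
  apply Lim_seq_le_loc; exists (S (S N0)); intros [|[|n]] Hn; [lia|lia|].
  rewrite majorant_partial_sum by reflexivity; fold b.
  apply Rle_trans with (2 := Hlow n).
  specialize (HN0 (S n) ltac:(lia)).
  assert (Hx0 : 0 <= x ^ S n) by (apply pow_le; exact Hx).
  rewrite Rabs_pos_eq in HN0 by exact Hx0.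
  assert (K * x ^ S n * r <= d / 2); [|unfold d in *; lra].
  replace (K * x ^ S n * r) with (K * r * x ^ S n) by ring.
  apply Rle_trans with ((K * r + 1) * (d / (2 * (K * r + 1)))).
  - apply Rmult_le_compat; try lra; nra.
  - right; field; nra. }
pose proof (Rbar_le_trans _ _ _ Hge Hmaj) as H; simpl in H; lra.
Qed.

(** * The radius in terms of the Lambert function *)

(** With [w] the value of the Lambert function, [u = w / k = exp (-1 - w)] solves
    [ln u = -1 - k u].  The estimate [u ^ 2 * k <= 1] comes from [w <= exp (1 + w)];
    it shows that [u] tends to [0] as [a] tends to [1]. *)
Lemma bohr_formula_root (a : R) :
  0 < a < 1 -> 1 < 2 * a ^ 2 ->
  let k := (2 * a ^ 2 - 1) / (1 - a ^ 2) in
  exists u, 0 < u < 1 /\ bohr_formula a = (1 - u) / a /\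
            ln u = -1 - k * u /\ u ^ 2 * k <= 1.
Proof.
intros Ha Ha2 k.
assert (Ha1 : 0 < 1 - a ^ 2) by nra.
assert (Hk : 0 < k) by (apply Rdiv_lt_0_compat; lra).
assert (He := exp_pos (-1)).
assert (Hke : 0 < k * exp (-1)) by (apply Rmult_lt_0_compat; lra).
destruct (LambertW_spec (k * exp (-1)) ltac:(lra)) as [_ Hw].
set (w := LambertW (k * exp (-1))) in *.
assert (Hew := exp_pos w).
assert (Hw0 : 0 < w) by nra.
assert (Hu : w / k = exp (-1 - w)).
{ replace (-1 - w) with (-1 + - w) by ring.
  rewrite exp_plus, exp_Ropp.
  apply Rmult_eq_reg_r with (k * exp w); [|nra].
  transitivity (w * exp w); [field; lra|rewrite Hw; field; lra]. }
exists (w / k); repeat split.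
- rewrite Hu; apply exp_pos.
- rewrite Hu, <- exp_0; apply exp_increasing; lra.
- unfold bohr_formula.
  replace ((1 - 2 * a ^ 2) / (a ^ 2 - 1)) with k by (unfold k; field; lra).
  fold w; unfold k; field; lra.
- rewrite Hu at 1; rewrite ln_exp; field; lra.
- replace ((w / k) ^ 2 * k) with (w * (w / k)) by (field; lra).
  rewrite Hu; replace (-1 - w) with (- (1 + w)) by ring; rewrite exp_Ropp.
  pose proof (exp_ineq1_le (1 + w)); pose proof (exp_pos (1 + w)).
  apply Rmult_le_reg_r with (exp (1 + w)); [lra|].
  rewrite Rmult_assoc, Rinv_l by lra; lra.
Qed.

Lemma extremal_primitive_bohr_formula (a : R) :
  0 < a < 1 -> 1 < 2 * a ^ 2 ->
  0 < bohr_formula a /\ a * bohr_formula a < 1 /\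
  extremal_primitive a (bohr_formula a) = 1.
Proof.
intros Ha Ha2; assert (Ha1 : 0 < 1 - a ^ 2) by nra.
destruct (bohr_formula_root a Ha Ha2) as [u [Hu [HR [Hln _]]]].
rewrite HR; repeat split.
- apply Rdiv_lt_0_compat; lra.
- replace (a * ((1 - u) / a)) with (1 - u) by (field; lra); lra.
- unfold extremal_primitive.
  replace (1 - a * ((1 - u) / a)) with u by (field; lra).
  rewrite Hln; field; lra.
Qed.

(** By [bohr_formula_root] the formula is [(1 - u) / a] with
    [0 < u <= sqrt (1 / k)], and [1 / k] vanishes at [1]. *)
Lemma bohr_formula_at_left_1 : filterlim bohr_formula (at_left 1) (locally 1).
Proof.
apply (filterlim_le_le
  (fun a => / a * (1 - sqrt ((1 - a ^ 2) / (2 * a ^ 2 - 1))))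
  bohr_formula (fun a => / a) (Finite 1)).
- exists (mkposreal (1 / 10) ltac:(lra)); intros a Hball Hlt.
  change (Rabs (a - 1) < 1 / 10) in Hball; apply Rabs_def2 in Hball.
  assert (Ha2 : 1 < 2 * a ^ 2) by nra.
  assert (Ha1 : 0 < 1 - a ^ 2) by nra.
  destruct (bohr_formula_root a ltac:(lra) Ha2) as [u [Hu [HR [_ Hk]]]].
  assert (Hus : u <= sqrt ((1 - a ^ 2) / (2 * a ^ 2 - 1))).
  { rewrite <- (sqrt_pow2 u) by lra; apply sqrt_le_1_alt.
    apply Rmult_le_reg_r with ((2 * a ^ 2 - 1) / (1 - a ^ 2)).
    - apply Rdiv_lt_0_compat; lra.
    - apply Rle_trans with (1 := Hk); right; field; lra. }
  assert (0 < / a) by (apply Rinv_0_lt_compat; lra).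
  rewrite HR; unfold Rdiv; rewrite (Rmult_comm (1 - u)); split; nra.
- apply filterlim_filter_le_1 with (1 := filter_le_within (fun x => x < 1)).
  assert (E : / 1 * (1 - sqrt ((1 - 1 ^ 2) / (2 * 1 ^ 2 - 1))) = 1).
  { replace ((1 - 1 ^ 2) / (2 * 1 ^ 2 - 1)) with 0 by field.
    rewrite sqrt_0; field. }
  replace (Rbar_locally 1)
    with (locally (/ 1 * (1 - sqrt ((1 - 1 ^ 2) / (2 * 1 ^ 2 - 1)))))
    by now rewrite E.
  apply (continuous_mult (K := R_AbsRing) (fun a => / a)
           (fun a => 1 - sqrt ((1 - a ^ 2) / (2 * a ^ 2 - 1)))).
  + apply continuous_Rinv; lra.
  + apply (continuous_minus (V := R_NormedModule)); [apply continuous_const|].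
    apply continuous_sqrt_comp.
    apply (ex_derive_continuous (fun a => (1 - a ^ 2) / (2 * a ^ 2 - 1))).
    auto_derive; lra.
- apply filterlim_filter_le_1 with (1 := filter_le_within (fun x => x < 1)).
  replace (Rbar_locally 1) with (locally (/ 1)) by (rewrite Rinv_1; reflexivity).
  apply continuous_Rinv; lra.
Qed.

(** * The threshold [a0] *)

Lemma a0_spec :
  1 / 2 <= a0 ^ 2 /\ 0 <= a0 /\
  2 * (a0 ^ 2 - 1) * exp (2 * (a0 ^ 2 - 1)) = - (2 / exp 2).
Proof.
assert (He2 := exp_pos 2).
assert (Hx : - exp (-1) <= - (2 / exp 2)).
{ replace (exp (-1)) with (exp 1 / exp 2).
  - apply Ropp_le_contravar, Rmult_le_compat_r;
      [left; now apply Rinv_0_lt_compat|].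
    pose proof (exp_ineq1_le 1); lra.
  - replace (-1) with (1 + Ropp 2) by ring.
    now rewrite exp_plus, exp_Ropp. }
destruct (LambertW_spec _ Hx) as [Hw1 Hw2].
set (W0 := LambertW (- (2 / exp 2))) in *.
assert (E : a0 ^ 2 = 1 + W0 / 2).
{ unfold a0; fold W0; rewrite pow2_sqrt; lra. }
repeat split; [lra|apply sqrt_pos|].
replace (2 * (a0 ^ 2 - 1)) with W0 by lra; exact Hw2.
Qed.

(** [2 (a0^2 - 1)] is a point of [[-1, +oo)], where [w * exp w] increases, so
    comparing [a0] with [x] amounts to comparing the values of this function. *)
Lemma a0_lt_iff (x : R) :
  0 <= x -> 1 / 2 <= x ^ 2 -> (a0 < x <-> (1 - x ^ 2) * exp (2 * x ^ 2) < 1).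
Proof.
intros Hx Hx2; destruct a0_spec as [Ha2 [Ha0 HE]].
assert (He2 := exp_pos 2).
assert (Hval : 2 * (x ^ 2 - 1) * exp (2 * (x ^ 2 - 1))
               = - (2 * ((1 - x ^ 2) * exp (2 * x ^ 2)) / exp 2)).
{ replace (2 * (x ^ 2 - 1)) with (2 * x ^ 2 + Ropp 2) at 2 by ring.
  rewrite exp_plus, exp_Ropp; field; lra. }
assert (Hscale : forall y, - (2 * y / exp 2) * (exp 2 / 2) = - y)
  by (intros y; field; lra).
assert (Hpos : 0 < exp 2 / 2) by lra.
split; intros H.
- assert (Hlt : 2 * (a0 ^ 2 - 1) < 2 * (x ^ 2 - 1)) by nra.
  apply mul_exp_lt in Hlt; [|lra].
  rewrite HE, Hval in Hlt; apply (Rmult_lt_compat_r _ _ _ Hpos) in Hlt.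
  rewrite Hscale in Hlt.
  replace (- (2 / exp 2) * (exp 2 / 2)) with (-1) in Hlt by (field; lra).
  lra.
- apply Rnot_le_lt; intros Hle.
  assert (Hle2 : 2 * (x ^ 2 - 1) <= 2 * (a0 ^ 2 - 1)) by nra.
  assert (Hm : 2 * (x ^ 2 - 1) * exp (2 * (x ^ 2 - 1)) <= - (2 / exp 2)).
  { rewrite <- HE; destruct Hle2 as [Hlt| ->]; [|apply Rle_refl].
    left; apply mul_exp_lt; [lra|exact Hlt]. }
  rewrite Hval in Hm; apply (Rmult_le_compat_r _ _ _ (Rlt_le _ _ Hpos)) in Hm.
  rewrite Hscale in Hm.
  replace (- (2 / exp 2) * (exp 2 / 2)) with (-1) in Hm by (field; lra).
  lra.
Qed.

Lemma Derive_n_exp (n : nat) (x : R) : Derive_n exp n x = exp x.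
Proof.
revert x; induction n as [|n IH]; intros x; [reflexivity|].
simpl; rewrite (Derive_ext _ exp) by exact IH.
apply is_derive_unique, is_derive_exp.
Qed.

Lemma exp_taylor_bounds (n : nat) (x : R) :
  0 < x ->
  let T := sum_f_R0 (fun m => x ^ m / INR (Factorial.fact m)) n in
  T <= exp x /\ exp x * (1 - x ^ S n / INR (Factorial.fact (S n))) <= T.
Proof.
intros Hx T.
destruct (Taylor_Lagrange exp n 0 x Hx) as [y [Hy E]].
{ intros t _ [|k] _; [exact I|].
  apply ex_derive_ext with exp; [intros; symmetry; apply Derive_n_exp|].
  exists (exp t); apply is_derive_exp. }
rewrite Rminus_0_r, Derive_n_exp in E.
rewrite (sum_eq _ (fun m => x ^ m / INR (Factorial.fact m))) in E.
2: { intros m _; rewrite Derive_n_exp, exp_0; ring. }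
fold T in E.
assert (Hr : 0 <= x ^ S n / INR (Factorial.fact (S n))).
{ apply Rdiv_le_0_compat; [apply pow_le; lra|apply INR_fact_lt_0]. }
assert (Hye : exp y <= exp x) by (left; apply exp_increasing; lra).
pose proof (exp_pos y).
set (r := x ^ S n / INR (Factorial.fact (S n))) in *.
split; nra.
Qed.

(** By [a0_lt_iff] this is a pair of estimates of [exp] near [1.5936] with relative
    error about [1e-6]; the Taylor remainder of order 14 is below [1e-8]. *)
Lemma a0_numeric : 892643 / 10 ^ 6 <= a0 < 892644 / 10 ^ 6.
Proof.
split.
- apply Rnot_lt_le; intros H.
  apply a0_lt_iff in H; [|lra|lra].
  destruct (exp_taylor_bounds 13 (2 * (892643 / 10 ^ 6) ^ 2) ltac:(lra)) as [Hlo _].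
  set (e := exp (2 * (892643 / 10 ^ 6) ^ 2)) in *.
  cbn [sum_f_R0] in Hlo.
  rewrite !fact_simpl, !mult_INR in Hlo.
  simpl INR in Hlo. lra.
- apply a0_lt_iff; [lra|lra|].
  destruct (exp_taylor_bounds 13 (2 * (892644 / 10 ^ 6) ^ 2) ltac:(lra)) as [_ Hhi].
  set (e := exp (2 * (892644 / 10 ^ 6) ^ 2)) in *.
  cbn [sum_f_R0] in Hhi.
  rewrite !fact_simpl, !mult_INR in Hhi.
  simpl INR in Hhi. lra.
Qed.

(** * The Bohr radius *)

(** This is where [a0] enters: [a0 < a] means [ln (1 - a^2) < - 2 a^2], hence
    [extremal_primitive a a >= 1], so that the root is at most [a] and
    [bombieri_bound] applies on the whole interval up to it. *)
Lemma bohr_formula_le (a : R) : a0 < a < 1 -> 1 < 2 * a ^ 2 ->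
  bohr_formula a <= a.
Proof.
intros Ha Ha2; destruct a0_spec as [_ [Ha0 _]].
destruct (extremal_primitive_bohr_formula a ltac:(lra) Ha2) as [HR [HaR HP]].
assert (Ha1 : 0 < 1 - a ^ 2) by nra.
pose proof (proj1 (a0_lt_iff a ltac:(lra) ltac:(lra)) (proj1 Ha)) as H.
assert (Hln : ln (1 - a ^ 2) <= - (2 * a ^ 2)).
{ left; rewrite <- (ln_exp (- (2 * a ^ 2))); apply ln_increasing; [lra|].
  rewrite exp_Ropp; pose proof (exp_pos (2 * a ^ 2)).
  apply Rmult_lt_reg_r with (exp (2 * a ^ 2)); [lra|].
  rewrite Rinv_l by lra; exact H. }
assert (Hat : 1 <= extremal_primitive a a).
{ unfold extremal_primitive; replace (a * a) with (a ^ 2) by ring.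
  replace ((2 * a ^ 2 - 1) / a * a) with (2 * a ^ 2 - 1) by (field; lra).
  assert (Hc : 0 < (1 - a ^ 2) / a ^ 2) by (apply Rdiv_lt_0_compat; nra).
  apply (Rmult_le_compat_l _ _ _ (Rlt_le _ _ Hc)) in Hln.
  replace ((1 - a ^ 2) / a ^ 2 * - (2 * a ^ 2)) with (- (2 * (1 - a ^ 2))) in Hln
    by (field; lra).
  lra. }
apply Rnot_lt_le; intros Hlt.
pose proof (extremal_primitive_increasing a a (bohr_formula a)
              ltac:(lra) ltac:(lra) HaR).
lra.
Qed.

Lemma bohr_radius_formula (a : R) :
  a0 < a < 1 -> is_bohr_radius a (bohr_formula a).
Proof.
intros Ha.
destruct a0_numeric as [Hlo _].
assert (Ha2 : 1 < 2 * a ^ 2) by nra.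
destruct (extremal_primitive_bohr_formula a ltac:(lra) Ha2) as [HR [HaR HP]].
split.
- apply (bohr_admissible_of_primitive a _ (extremal_primitive a)).
  + lra.
  + split; [lra|exact (bohr_formula_le a Ha Ha2)].
  + intros t Ht; apply is_derive_extremal_primitive; nra.
  + apply extremal_primitive_0.
  + intros r Hr; rewrite <- HP.
    destruct (Rle_lt_or_eq_dec _ _ (proj2 Hr)) as [Hlt| ->]; [|apply Rle_refl].
    left; apply extremal_primitive_increasing; lra.
- apply le_of_bohr_admissible; lra.
Qed.

Lemma bohr_radius_1 : is_bohr_radius 1 1.
Proof.
split.
- apply (bohr_admissible_of_primitive 1 1 (fun r => r)); try (intros; lra).
  intros t _; replace (bombieri_majorant 1 t) with 1
    by (unfold bombieri_majorant, Rdiv; ring).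
  apply (is_derive_id (K := R_AbsRing)).
- intros rho [Hrho Hadm].
  destruct (extremal_function 1 ltac:(lra)) as [f [Hf Hsup]].
  specialize (Hadm f _ Hf Hsup ltac:(simpl; exact Cmod_1) rho ltac:(lra)).
  apply (Rbar_le_trans rho (Defs.majorant (fun n => extremal_coef 1 n) rho) 1);
    [|exact Hadm].
  apply Rbar_le_trans with (Lim_seq (fun _ => rho));
    [rewrite Lim_seq_const; apply Rbar_le_refl|].
  apply Lim_seq_le_loc; exists 1%nat; intros [|n] Hn; [lia|].
  rewrite Rsum_shift, (Rsum_head (fun k => _ * rho ^ S k)).
  + simpl; rewrite Cmod_0, Cmod_1; lra.
  + intros [|k] Hk; [lia|].
    replace (extremal_coef 1 (S (S k))) with 0
      by (cbn [extremal_coef]; unfold Rdiv; ring).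
    rewrite Cmod_0; ring.
Qed.

Theorem theorem5 :
  892643 / 10 ^ 6 <= a0 < 892644 / 10 ^ 6 /\
  filterlim bohr_formula (at_left 1) (locally 1) /\
  (forall a : R, a0 < a <= 1 -> is_bohr_radius a (bohr_value a)).
Proof.
split; [exact a0_numeric|split; [exact bohr_formula_at_left_1|]].
intros a Ha; unfold bohr_value; destruct (Req_EM_T a 1) as [-> | Hne].
- exact bohr_radius_1.
- apply bohr_radius_formula; lra.
Qed.
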